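(* Let $\nu_\phi,\nu_\psi$ be the $T$-invariant Gibbs probability measures on $\mathbb{S}^1$ associated to normalized Hölder potentials $\phi,\psi$, where $T$ is the doubling map. Let $$\kappa_{\phi,\psi,\mathbb{S}^1}:=\sup\{\kappa>0:\ \nu_\psi(I^\kappa(s))=1 \text{ for } \nu_\phi\text{-a.e. } s\}.$$ Then $$\kappa_{\phi,\psi,\mathbb{S}^1}=\frac{1}{\int(-\phi)\,d\nu_\psi}.$$
   Context: $\mathbb{S}^1=\mathbb{R}/\mathbb{Z}$ and $T:\mathbb{S}^1\to\mathbb{S}^1$, $Ts=2s \pmod 1$. All logarithms and exponentials are to base 2 (so entropies and pressures are computed in base 2). A Hölder potential $\phi$ is normalized if its pressure $P(\phi)=\sup_\nu\{h_\nu+\int\phi\,d\nu\}$ (sup over $T$-invariant probability measures) is $0$; the Gibbs measure $\nu_\phi$ is the $T$-invariant probability measure for which $\nu_\phi(J)$ is comparable, uniformly in $n$, in the dyadic interval $J$ of length $2^{-n}$ and in $x\in J$, to $2^{\sum_{j=0}^{n-1}\phi(T^jx)}$. For $\kappa>0$ and $s\in\mathbb{S}^1$ put $J^\kappa_n(s)=(T^ns-n^{-\kappa} \bmod 1,\ T^ns+n^{-\kappa} \bmod 1)$ for $n\ge1$, and $$I^\kappa(s)=\bigcap_{N=1}^\infty\bigcup_{n=N}^\infty J^\kappa_n(s).$$ *)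

(* Defs.v *)
From HB Require Import structures.
From mathcomp Require Import all_boot all_order all_algebra.
From mathcomp Require Import all_classical all_reals all_analysis.

Set Implicit Arguments.
Unset Strict Implicit.
Unset Printing Implicit Defensive.

Import Order.TTheory GRing.Theory Num.Theory numFieldNormedType.Exports.

Local Open Scope classical_set_scope.
Local Open Scope quotient_scope.
Local Open Scope ring_scope.

(* R / Z, as the quotient of the additive group of R by its subgroup of
   integers, with the quotient topology and the Borel sigma-algebra. *)
Definition circle (R : realType) : Type :=
  Quotient.quot (GRing.ZmodClosed.clone R (@Num.int_num_subdef R) _).

HB.instance Definition _ (R : realType) := EqQuotient.on (circle R).
HB.instance Definition _ (R : realType) := GRing.Zmodule.on (circle R).
HB.instance Definition _ (R : realType) := ZmodQuotient.on (circle R).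

Section circle_topology.
Variable R : realType.

Definition circle_open (U : set (circle R)) :=
  open ((\pi_(circle R) : R -> circle R) @^-1` U).

Let circle_openT : circle_open setT.
Proof. by rewrite /circle_open preimage_setT; exact: openT. Qed.

Let circle_openI (A B : set (circle R)) :
  circle_open A -> circle_open B -> circle_open (A `&` B).
Proof. exact: openI. Qed.

Let circle_open_bigU (I : Type) (f : I -> set (circle R)) :
  (forall i, circle_open (f i)) -> circle_open (\bigcup_i f i).
Proof. by move=> fo; apply: bigcup_open => i _; exact: fo. Qed.

HB.instance Definition _ := isOpenTopological.Build (circle R)
  circle_openT circle_openI circle_open_bigU.

HB.instance Definition _ := isPointed.Build (circle R) 0.

HB.instance Definition _ := Measurable.copy (circle R)
  (g_sigma_algebraType (@open (circle R))).

End circle_topology.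

Section measure_preserving_dynamics.
Context {d : measure_display} {X : measurableType d} {R : realType}.
Variables (f : X -> X) (nu : probability X R).

Definition invariant_measure :=
  forall A : set X, measurable A -> nu (f @^-1` A) = nu A.

Definition log2 (x : R) : R := ln x / ln 2.

(* A finite measurable partition of X is given by its labelling
   xi : X -> 'I_k; the atoms of the join of the f^-j xi for j < n are then
   indexed by words of length n over 'I_k. *)
Definition join_atom (k : nat) (xi : X -> 'I_k) (n : nat)
    (w : {ffun 'I_n -> 'I_k}) : set X :=
  [set x | forall j : 'I_n, xi (iter j f x) = w j].

(* The convention 0 log 0 = 0 holds because ln 0 = 0. *)
Definition join_entropy (k : nat) (xi : X -> 'I_k) (n : nat) : R :=
  - \sum_(w : {ffun 'I_n -> 'I_k})
      fine (nu (join_atom xi w)) * log2 (fine (nu (join_atom xi w))).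

(* Meaningful for invariant nu, in which case the limit exists by
   subadditivity. *)
Definition partition_entropy (k : nat) (xi : X -> 'I_k) : R :=
  limn (fun n : nat => join_entropy xi n / n%:R).

(* Kolmogorov-Sinai entropy in base 2. *)
Definition entropy : \bar R :=
  ereal_sup [set h | exists (k : nat) (xi : X -> 'I_k),
    (forall i, measurable (xi @^-1` [set i])) /\
    h = (partition_entropy xi)%:E].

End measure_preserving_dynamics.

Section doubling_map.
Variable R : realType.
Local Notation S1 := (circle R).
Local Notation proj := (\pi_(circle R) : R -> circle R).

Definition doubling (s : S1) : S1 := s *+ 2.

Definition circle_dist (x y : S1) : R :=
  inf [set `|t| | t in [set t : R | proj t = x - y]].

Definition holder_continuous (phi : S1 -> R) :=
  exists alpha C : R, 0 < alpha <= 1 /\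
    forall x y : S1, `|phi x - phi y| <= C * circle_dist x y `^ alpha.

Definition pressure (phi : S1 -> R) : \bar R :=
  ereal_sup [set (entropy doubling nu + \int[nu]_x (phi x)%:E)%E |
    nu in [set nu : probability S1 R | invariant_measure doubling nu]].

Definition normalized (phi : S1 -> R) := pressure phi = 0%E.

Definition dyadic_interval (n k : nat) : set S1 :=
  proj @` `[k%:R / 2 ^+ n, k.+1%:R / 2 ^+ n[%classic.

Definition birkhoff_sum (phi : S1 -> R) (n : nat) (x : S1) : R :=
  \sum_(j < n) phi (iter j doubling x).

Definition gibbs_measure (phi : S1 -> R) (nu : probability S1 R) :=
  invariant_measure doubling nu /\
  exists2 C : R, 0 < C &
    forall n k : nat, (k < 2 ^ n)%N ->
    forall x : S1, dyadic_interval n k x ->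
      ((C^-1 * 2 `^ birkhoff_sum phi n x)%:E <= nu (dyadic_interval n k)
        <= (C * 2 `^ birkhoff_sum phi n x)%:E)%E.

Definition target_interval (kappa : R) (n : nat) (s : S1) : set S1 :=
  [set iter n doubling s + proj t |
    t in `]- (n%:R `^ (- kappa)), n%:R `^ (- kappa)[%classic].

Definition approx_set (kappa : R) (s : S1) : set S1 :=
  \bigcap_(N in [set N | (1 <= N)%N]) \bigcup_(n in [set n | (N <= n)%N])
    target_interval kappa n s.

Definition critical_exponent (nu_phi nu_psi : probability S1 R) : \bar R :=
  ereal_sup [set kappa%:E | kappa in [set kappa : R | 0 < kappa /\
    {ae nu_phi, forall s, nu_psi (approx_set kappa s) = 1%E}]].

End doubling_map.

(* Main.v *)
Require Import Defs.
From mathcomp Require Import all_boot all_order all_algebra.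
From mathcomp Require Import all_classical all_reals all_analysis.
From mathcomp Require Import measurable_realfun lra ring zify.

Set Implicit Arguments.
Unset Strict Implicit.
Unset Printing Implicit Defensive.

Import Order.TTheory GRing.Theory Num.Theory numFieldNormedType.Exports.

Local Open Scope classical_set_scope.
Local Open Scope quotient_scope.
Local Open Scope ring_scope.

(** Write alpha for the integral of - phi with respect to nu_psi. By the Gibbs
    property, minus the logarithm of the nu_phi-measure of the dyadic interval
    of length 2^-m around x is, up to a constant, minus the Birkhoff sum of phi
    over m steps at x; for nu_psi-typical x it is therefore about alpha m. So
    the ball of radius n^-kappa around such an x has nu_phi-measure about
    n^(- kappa alpha). A point x is in the random limsup set of s when the
    orbit of s enters this ball at infinitely many times n, and each of these
    events has, by invariance, the measure of the ball: the sum over n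
    converges for kappa > 1 / alpha and diverges for kappa < 1 / alpha. The
    statements on pairs (s, x) are turned into statements on almost every s by
    Tonelli's theorem ([ae_xsection_null]).

    Convergence ([approx_not_full]). Garsia's maximal ergodic inequality
    ([maximal_ergodic]), applied to - phi - b for some b in ]1 / kappa, alpha[,
    gives a set of positive nu_psi-measure of points x at which minus the
    Birkhoff sum over m steps is at least b m for all m. The balls around these
    points are small because the Gibbs estimate is stable under passing to an
    adjacent dyadic interval ([ball_le]), and Borel-Cantelli applies
    ([approx_set_null]). As the limsup sets only have to fail to have full
    measure, positive measure is enough here.

    Divergence ([approx_full]). The Gibbs property makes disjoint blocks of
    binary digits quasi-independent ([level_quasi_bernoulli]), hence the
    probability that a sequence of events on successive blocks all fail is
    at most that of independent trials, up to a constant in the success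
    probability ([prob_no_hit]). This is used for s, with the trials to enter
    the dyadic neighbourhood of x of scale m at the multiples of m
    ([target_hit]); and for x, to show that almost every x has infinitely many
    scales m at which the nu_phi-measure of its dyadic neighbourhood is at
    least 2^(- b m), for b in ]alpha, 1 / kappa[
    ([infinitely_many_large_cyl]). Infinitely many scales are enough, since at
    each of them the failure probability is small.

    That alpha is positive ([energy_pos]) follows from the exponential decay of
    the nu_phi-measure of dyadic intervals. *)

(** * Elementary real estimates *)

Lemma pow2_le (R : realType) (a b : R) : (2 `^ a <= 2 `^ b) = (a <= b).
Proof.
by rewrite /powR pnatr_eq0 /= ler_expR ler_pM2r // ln_gt0 // ltr1n.
Qed.

(** The exponential beats any linear function: a quadratic lower bound. *)
Lemma pow2_ge (R : realType) (g m : R) : 0 <= g -> 0 <= m ->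
  (g * ln 2 / 2 * m) ^+ 2 <= 2 `^ (g * m).
Proof.
move=> g0 m0; have l2 : 0 < ln (2 : R) by rewrite ln_gt0 // ltr1n.
have -> : 2 `^ (g * m) = expR (g * ln 2 / 2 * m) ^+ 2.
  by rewrite -expRM_natl /powR pnatr_eq0 /=; congr expR; field.
have h : 0 <= g * ln 2 / 2 * m by rewrite !mulr_ge0 ?invr_ge0 // ltW.
apply: lerXn2r; rewrite ?nnegrE ?expR_ge0 //.
by apply: le_trans (expR_ge1Dx _); rewrite lerDr.
Qed.

Lemma expr_small (R : realType) (q e : R) : 0 <= q -> q < 1 -> 0 < e ->
  exists n : nat, q ^+ n < e.
Proof.
move=> q0 q1 e0.
have : q ^+ n @[n --> \oo] --> (0 : R) by apply: cvg_expr; rewrite ger0_norm.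
move=> /cvgrPdist_lt /(_ e e0) [N _ /(_ N (leqnn N))] /=.
rewrite sub0r normrN ger0_norm ?exprn_ge0 // => H; by exists N.
Qed.

Lemma le_expr_eq0 (R : realType) (r q : R) : 0 <= r -> q < 1 ->
  (forall k : nat, r <= q ^+ k) -> r = 0.
Proof.
move=> r0 q1 H; apply/eqP; rewrite eq_le r0 andbT leNgt; apply/negP => rp.
have q0 : 0 <= q by have := H 1%N; rewrite expr1; exact: le_trans.
have [n] := expr_small q0 q1 rp.
by apply/negP; rewrite -leNgt.
Qed.

Lemma le_pow2 (R : realType) (C : R) : 0 < C -> exists2 L : R, 0 <= L & C <= 2 `^ L.
Proof.
move=> C0; exists `|ln C / ln 2| => //.
rewrite -[leLHS](@lnK _ C) ?posrE // /powR pnatr_eq0 /= ler_expR.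
have l2 : 0 < ln (2 : R) by rewrite ln_gt0 // ltr1n.
by rewrite -ler_pdivrMr // ler_norm.
Qed.

(** Bernoulli's inequality for 1 + p, divided by it: k independent trials of
    success probability p all fail with probability at most 1 / (1 + k p). *)
Lemma bernoulli_inverse (R : realType) (p : R) (k : nat) : 0 <= p -> p <= 1 ->
  (1 - p) ^+ k * (1 + k%:R * p) <= 1.
Proof.
move=> p0 p1; elim: k => [|k IH]; first by rewrite expr0; lra.
apply: le_trans IH; rewrite exprSr -mulrA; apply: ler_wpM2l.
  by rewrite exprn_ge0 // subr_ge0.
have := ler0n R k; rewrite -natr1; nra.
Qed.

Lemma sum_geometric_le (R : realType) (M r : R) n : 0 <= M -> 0 <= r -> r < 1 ->
  \sum_(0 <= i < n) M * r ^+ i <= M / (1 - r).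
Proof.
move=> M0 r0 r1; have r10 : 0 < 1 - r by rewrite subr_gt0.
suff -> : \sum_(0 <= i < n) M * r ^+ i = M * (1 - r ^+ n) / (1 - r).
  rewrite ler_pM2r ?invr_gt0 // ler_piMr // gerBl; exact: exprn_ge0.
elim: n => [|n IH]; first by rewrite big_nil expr0 subrr mulr0 mul0r.
by rewrite big_nat_recr //= IH exprSr; field; rewrite gt_eqF.
Qed.

(** Arithmetic of the block of times in [target_hit]: k is at least w - 1 - n
    and P <= 1 is (up to a constant) the success probability of one trial. *)
Lemma number_of_trials (R : realType) (w t k n P l a : R) :
  w < t + 1 -> t <= k + n -> 0 <= P -> P <= 1 -> 0 <= n -> l <= w * P ->
  a + 1 + n < l -> a <= k * P.
Proof.
move=> wt tk P0 P1 n0 lw al.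
have h1 : (w - 1 - n) * P <= k * P by rewrite ler_wpM2r //; lra.
have h2 : (1 + n) * P <= 1 + n by rewrite ler_piMr // addr_ge0.
by move: h1 h2; rewrite !mulrBl mulrDl mul1r; lra.
Qed.

(** Exponents in the measure of a dyadic block of times: 2^i times, each of
    measure about 2^(- b w), where w + 1 exceeds kappa i. *)
Lemma block_exponent (R : realType) (i w K b kappa : R) :
  b * (kappa * i) <= b * (w + 1) ->
  i + (K - b * w) <= K + b + (1 - kappa * b) * i.
Proof. lra. Qed.

(** * Dyadic coordinates on the circle *)

Section circle_coordinates.
Variable R : realType.
Local Notation S1 := (circle R).
Local Notation proj := (\pi_(circle R) : R -> circle R).

Lemma proj_eqP (s t : R) : proj s = proj t <-> exists z : int, s = t + z%:~R.
Proof.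
have E := @Quotient.idealrBE R
  (GRing.ZmodClosed.clone R (@Num.int_num_subdef R) _) s t.
split=> [/eqP H|[z ->]].
  have : s - t \is a Num.int by move: H; rewrite -E.
  by move=> /intrP[z Hz]; exists z; rewrite -Hz addrC subrK.
have E' := @Quotient.idealrBE R
  (GRing.ZmodClosed.clone R (@Num.int_num_subdef R) _) (t + z%:~R) t.
have : t + z%:~R - t \is a Num.int by rewrite addrC addKr intr_int.
by move=> H; apply/eqP; rewrite -E'.
Qed.

Lemma projB (s t : R) : proj (s - t) = proj s - proj t.
Proof. exact: raddfB. Qed.

(** The representative in [0, 1[ of a point of the circle. *)
Definition fpart (x : S1) : R := repr x - (Num.floor (repr x))%:~R.

Lemma fpartK (x : S1) : proj (fpart x) = x.
Proof.
rewrite -[RHS]reprK; apply/proj_eqP; exists (- Num.floor (repr x)).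
by rewrite mulrNz.
Qed.

Lemma fpart_ge0 (x : S1) : 0 <= fpart x.
Proof. by rewrite subr_ge0; case/andP: (floor_itv (repr x)). Qed.

Lemma fpart_lt1 (x : S1) : fpart x < 1.
Proof.
rewrite ltrBlDl; case/andP: (floor_itv (repr x)) => _.
by rewrite intrD.
Qed.

Lemma fpart_proj (t : R) : 0 <= t < 1 -> fpart (proj t) = t.
Proof.
move=> /andP[t0 t1].
have /proj_eqP[z Hz] : proj (fpart (proj t)) = proj t by rewrite fpartK.
have := fpart_ge0 (proj t); have := fpart_lt1 (proj t).
rewrite Hz => h1 h2.
have z1 : z%:~R < (1%:~R : R) by rewrite [ltRHS]/=; lra.
have z2 : (-1)%:~R < (z%:~R : R) by rewrite mulrNz; lra.
move: z1 z2; rewrite !ltr_int => z1 z2.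
have -> : z = 0 by lia.
by rewrite addr0.
Qed.

Lemma iter_doubling_proj n (t : R) :
  iter n (@doubling R) (proj t) = proj (2 ^+ n * t).
Proof.
elim: n => [|n IH]; first by rewrite expr0 mul1r.
by rewrite iterS IH /doubling -raddfMn exprS -mulrA [2 * _]mulr_natl.
Qed.

Lemma iter_doublingE n (x : S1) :
  iter n (@doubling R) x = proj (2 ^+ n * fpart x).
Proof. by rewrite -iter_doubling_proj fpartK. Qed.

(** The index of the dyadic interval of length 2^-n that contains x, that is,
    the integer whose binary expansion is given by the first n digits of x. *)
Definition code (n : nat) (x : S1) : nat := Num.truncn (2 ^+ n * fpart x).

Lemma code_itv n (x : S1) :
  (code n x)%:R <= 2 ^+ n * fpart x < (code n x).+1%:R.
Proof. by apply: truncn_itv; rewrite mulr_ge0 ?exprn_ge0 ?fpart_ge0. Qed.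

Lemma code_lt n (x : S1) : (code n x < 2 ^ n)%N.
Proof.
rewrite truncn_lt_nat ?natrX; last by rewrite mulr_ge0 ?exprn_ge0 ?fpart_ge0.
by rewrite gtr_pMr ?exprn_gt0 ?fpart_lt1.
Qed.

Lemma fpart_iter n (x : S1) :
  fpart (iter n (@doubling R) x) = 2 ^+ n * fpart x - (code n x)%:R.
Proof.
have /andP[h1 h2] := code_itv n x.
rewrite iter_doublingE.
have -> : proj (2 ^+ n * fpart x) = proj (2 ^+ n * fpart x - (code n x)%:R).
  by apply/proj_eqP; exists (Posz (code n x)); rewrite -pmulrn subrK.
rewrite fpart_proj // subr_ge0 h1 /= ltrBlDr.
by rewrite addrC natr1.
Qed.

(** Concatenation of binary words: the first n + l digits of x are its first
    n digits followed by the first l digits of its n-th iterate. *)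
Lemma codeD n l (x : S1) :
  code (n + l) x = (code n x * 2 ^ l + code l (iter n (@doubling R) x))%N.
Proof.
have /andP[h1 h2] := code_itv l (iter n (@doubling R) x).
apply: truncn_def.
have -> : 2 ^+ (n + l) * fpart x =
    2 ^+ l * fpart (iter n (@doubling R) x) + (code n x * 2 ^ l)%:R.
  by rewrite fpart_iter natrM natrX exprD; ring.
rewrite -addnS !natrD; apply/andP; split; lra.
Qed.

Lemma codeDP n l (x : S1) (i j : nat) : (i < 2 ^ l)%N ->
  code (n + l) x = (j * 2 ^ l + i)%N <->
  code n x = j /\ code l (iter n (@doubling R) x) = i.
Proof.
move=> il; rewrite codeD; split=> [E|[-> ->] //].
have cl := code_lt l (iter n (@doubling R) x).
have l0 : (0 < 2 ^ l)%N by rewrite expn_gt0.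
have := congr1 (divn^~ (2 ^ l)%N) E.
rewrite /= !divnMDl // !divn_small // !addn0 => Ej; split=> //.
by move: E; rewrite Ej => /addnI.
Qed.

Lemma dyadic_intervalE n k : (k < 2 ^ n)%N ->
  @dyadic_interval R n k = [set x | code n x = k].
Proof.
move=> kn; have n0 : (0 : R) < 2 ^+ n by rewrite exprn_gt0.
apply/seteqP; split=> [x [t]|x] /=.
  rewrite /= in_itv /= => /andP[t1 t2] <-.
  have k1 : k.+1%:R <= (2 : R) ^+ n by rewrite -natrX ler_nat.
  apply: truncn_def; rewrite fpart_proj.
    by rewrite -ler_pdivrMl // -ltr_pdivlMl // ![_^-1 * _]mulrC t1.
  apply/andP; split; first by apply: le_trans t1; rewrite divr_ge0 // ltW.
  by apply: lt_le_trans t2 _; rewrite ler_pdivrMr // mul1r.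
move=> <-; exists (fpart x); last exact: fpartK.
have /andP[h1 h2] := code_itv n x.
by rewrite /= in_itv /= ler_pdivrMr // ltr_pdivlMr // mulrC h1.
Qed.

Lemma code_nonempty n k : (k < 2 ^ n)%N -> exists x : S1, code n x = k.
Proof.
move=> kn; exists (proj (k%:R / 2 ^+ n)).
have n0 : (0 : R) < 2 ^+ n by rewrite exprn_gt0.
have : @dyadic_interval R n k (proj (k%:R / 2 ^+ n)).
  exists (k%:R / 2 ^+ n) => //=.
  by rewrite in_itv /= lexx /= ltr_pM2r ?invr_gt0 // ltr_nat.
by rewrite dyadic_intervalE.
Qed.

End circle_coordinates.

(** * Borel measurability on the circle *)

Section circle_measurability.
Variable R : realType.
Local Notation S1 := (circle R).
Local Notation proj := (\pi_(circle R) : R -> circle R).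

Lemma open_circle (U : set S1) : open (proj @^-1` U) -> open U.
Proof. by []. Qed.

Lemma open_proj_preimage (U : set S1) : open U -> open (proj @^-1` U).
Proof. by []. Qed.

(** The quotient map is open. *)
Lemma open_proj_image (U : set R) : open U -> open (proj @` U).
Proof.
move=> oU; apply: open_circle.
rewrite (_ : _ @^-1` _ = \bigcup_(z in [set: int]) ((fun t => t + z%:~R) @^-1` U)).
  apply: bigcup_open => z _; apply: open_comp => // t _.
  by apply: cvgD; [exact: cvg_id|exact: cvg_cst].
apply/seteqP; split=> [t [s Us /proj_eqP[z E]]|t [z _ Uz]] /=.
  by exists z => //=; rewrite -E.
by exists (t + z%:~R) => //; apply/proj_eqP; exists z.
Qed.

Lemma open_measurable_circle (U : set S1) : open U -> measurable U.
Proof. by move=> oU; apply: sub_sigma_algebra. Qed.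

Lemma measurable_circle_fun d (T : measurableType d) (f : T -> S1) :
  (forall U : set S1, open U -> measurable (f @^-1` U)) -> measurable_fun setT f.
Proof.
move=> H; apply: (measurability (@open S1)) => //.
by move=> _ [U oU <-]; rewrite setTI; exact: H.
Qed.

Lemma measurable_fpart : measurable_fun setT (@fpart R).
Proof.
apply: (measurability _ (RGenOInfty.measurableE R)) => //.
move=> _ [_ [a ->]] <-; rewrite setTI.
have [a0|a0] := ltP a 0.
  rewrite (_ : _ @^-1` _ = setT) // -subTset => x _ /=.
  by rewrite in_itv /= andbT (lt_le_trans a0) // fpart_ge0.
rewrite (_ : _ @^-1` _ = proj @` `]a, 1[%classic).
  by apply: open_measurable_circle; apply: open_proj_image; exact: interval_open.
apply/seteqP; split=> [x|x [t]] /=; rewrite !in_itv/=.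
  by rewrite andbT => ax; exists (fpart x); rewrite ?fpartK // in_itv/= ax fpart_lt1.
move=> /andP[at_ t1] <-; rewrite fpart_proj ?at_ //.
by rewrite t1 (le_trans a0) // ltW.
Qed.

Lemma measurable_doubling : measurable_fun setT (@doubling R).
Proof.
apply: measurable_circle_fun => U oU; apply: open_measurable_circle.
apply: open_circle.
rewrite (_ : _ @^-1` _ = (fun t : R => 2 * t) @^-1` (proj @^-1` U)).
  apply: open_comp; last exact: open_proj_preimage.
  by move=> t _; apply: cvgM; [exact: cvg_cst|exact: cvg_id].
by apply/seteqP; split=> t /=; rewrite -[doubling (proj t)]/(iter 1 (@doubling R) (proj t))
  iter_doubling_proj expr1.
Qed.

Lemma measurable_iter n : measurable_fun setT (iter n (@doubling R)).
Proof.
elim: n => [|n IH]; first exact: measurable_id.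
by apply: (measurableT_comp measurable_doubling IH).
Qed.

Lemma measurable_code n (P : set nat) : measurable [set x : S1 | P (code n x)].
Proof.
rewrite (_ : [set _ | _] = \bigcup_(k in P) [set x : S1 | code n x = k]); last first.
  by apply/seteqP; split=> [x Px|x [k Pk /= E]] /=; [exists (code n x)|rewrite E].
apply: bigcup_measurable => k _.
rewrite (_ : [set _ | _] = (fun x : S1 => 2 ^+ n * fpart x) @^-1`
   `[k%:R, k.+1%:R[%classic).
  have mf : measurable_fun setT (fun x : S1 => 2 ^+ n * fpart x).
    by apply: measurable_funM; [exact: measurable_cst|exact: measurable_fpart].
  by rewrite -[X in measurable X]setTI; exact: mf.
apply/seteqP; split=> x /=; rewrite in_itv /=.
  by move=> <-; exact: code_itv.
exact: truncn_def.
Qed.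

End circle_measurability.

(** * Probabilities as real numbers *)

Section real_valued_probability.
Context {d : measure_display} {T : measurableType d} {R : realType}.
Variable P : probability T R.
Implicit Types A B : set T.

(** The probability of an event as a real number; it is only used on
    measurable sets, where it determines the measure. *)
Definition prob A : R := fine (P A).

Lemma probE A : measurable A -> P A = (prob A)%:E.
Proof. by move=> mA; rewrite /prob fineK // fin_num_measure. Qed.

Lemma prob_ge0 A : 0 <= prob A.
Proof. exact: fine_ge0. Qed.

Lemma prob_le1 A : measurable A -> prob A <= 1.
Proof. by move=> mA; rewrite -lee_fin -probE // probability_le1. Qed.

Lemma probT : prob setT = 1.
Proof. by rewrite /prob probability_setT. Qed.

Lemma prob0 : prob set0 = 0.
Proof. by rewrite /prob measure0. Qed.

Lemma prob_le A B : measurable A -> measurable B -> A `<=` B -> prob A <= prob B.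
Proof.
by move=> mA mB AB; rewrite -lee_fin -!probE // le_measure // inE.
Qed.

Lemma probU A B : measurable A -> measurable B -> A `&` B = set0 ->
  prob (A `|` B) = prob A + prob B.
Proof.
move=> mA mB AB; apply: EFin_inj; rewrite EFinD -!probE //; last exact: measurableU.
by rewrite measureU.
Qed.

Lemma prob_setIC A B : measurable A -> measurable B ->
  prob A = prob (A `&` B) + prob (A `&` ~` B).
Proof.
move=> mA mB; rewrite -probU.
- by rewrite -setIUr setUv setIT.
- exact: measurableI.
- by apply: measurableI => //; exact: measurableC.
- by rewrite setIACA setICr setI0.
Qed.

Lemma probC A : measurable A -> prob (~` A) = 1 - prob A.
Proof.
by move=> mA; have := prob_setIC measurableT mA; rewrite !setTI probT => ->; lra.
Qed.

(** The law of total probability, for the values of f. *)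
Lemma prob_partition (f : T -> nat) N A : measurable A ->
  (forall k, measurable [set x | f x = k]) -> (forall x, A x -> (f x < N)%N) ->
  prob A = \sum_(k < N) prob (A `&` [set x | f x = k]).
Proof.
move=> + mf; elim: N A => [|N IH] A mA fN.
  rewrite big_ord0; have -> : A = set0; last exact: prob0.
  by rewrite -subset0 => x /fN.
have mA1 : measurable (A `&` ~` [set x | f x = N]).
  by apply: measurableI => //; exact: measurableC.
rewrite big_ord_recr /= (prob_setIC mA (mf N)) addrC (IH _ mA1).
  congr (_ + _); apply: eq_bigr => k _; congr prob.
  rewrite -setIA; congr (_ `&` _); apply/seteqP; split=> [x [] //|x /= fk].
  by split=> //=; rewrite fk; apply/eqP; rewrite ltn_eqF.
by move=> x [/fN Ax /eqP fxN]; rewrite ltnS leq_eqVlt (negbTE fxN) in Ax.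
Qed.

End real_valued_probability.

Lemma prob_subadd d (T : measurableType d) (R : realType)
  (P : probability T R) (A B : set T) : measurable A -> measurable B ->
  prob P (A `|` B) <= prob P A + prob P B.
Proof.
move=> mA mB; rewrite -lee_fin EFinD -!probE //; last exact: measurableU.
exact: measureU2.
Qed.

Lemma prob_finite_union_le d (T : measurableType d) (R : realType)
  (P : probability T R) (A : nat -> set T) (p : R) (J : nat) :
  (forall j, measurable (A j)) -> (forall j, prob P (A j) <= p) ->
  measurable [set s | exists2 j, (j < J)%N & A j s] /\
  prob P [set s | exists2 j, (j < J)%N & A j s] <= J%:R * p.
Proof.
move=> mA Ap; elim: J => [|J [mU IH]].
  rewrite [X in measurable X](_ : _ = set0); last by rewrite -subset0 => s [].
  rewrite [X in prob _ X](_ : _ = set0); last by rewrite -subset0 => s [].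
  by split=> //; rewrite prob0 mul0r.
have E : [set s | exists2 j, (j < J.+1)%N & A j s] =
    [set s | exists2 j, (j < J)%N & A j s] `|` A J.
  apply/seteqP; split=> [s [j]|s [[j jJ As]|As]].
  - by rewrite ltnS leq_eqVlt => /predU1P[->|jJ]; [right|left; exists j].
  - by exists j => //; exact: ltnW.
  - by exists J.
rewrite E; split; first exact: measurableU.
apply: (le_trans (prob_subadd P mU (mA J))).
by rewrite -natr1 mulrDl mul1r lerD.
Qed.

Lemma prob_bigcup0 d (T : measurableType d) (R : realType) (P : probability T R)
  (F : nat -> set T) : (forall n, measurable (F n)) -> (forall n, prob P (F n) = 0) ->
  prob P (\bigcup_n F n) = 0.
Proof.
move=> mF F0; have mU : measurable (\bigcup_n F n) by exact: bigcupT_measurable.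
have /negligibleP : P.-negligible (\bigcup_n F n).
  apply: negligible_bigcup => n; apply/negligibleP => //.
  by have := probE P (mF n); rewrite F0.
by move=> /(_ mU); rewrite /prob => ->.
Qed.

Lemma borel_cantelli_geometric d (T : measurableType d) (R : realType)
  (P : probability T R) (F : nat -> set T) (M r : R) :
  0 <= M -> 0 <= r -> r < 1 -> (forall i, measurable (F i)) ->
  (forall i, prob P (F i) <= M * r ^+ i) -> P (lim_sup_set F) = 0%E.
Proof.
move=> M0 r0 r1 mF FM; apply: lim_sup_set_cvg0 => //.
apply: (@le_lt_trans _ _ ((M / (1 - r))%:E)); last exact: ltry.
apply: lime_le; first by apply: is_cvg_nneseries => n _ _; exact: measure_ge0.
apply: nearW => n.
rewrite (eq_bigr (fun i => (prob P (F i))%:E)); last by move=> i _; exact: probE.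
rewrite sumEFin lee_fin; apply: le_trans (sum_geometric_le n M0 r0 r1).
by apply: ler_sum => i _.
Qed.

(** * The quasi-Bernoulli property *)

(** The two-sided Gibbs estimate with explicit constant C, on all dyadic
    intervals. *)
Definition gibbs_bounds (R : realType) (phi : circle R -> R)
    (nu : probability (circle R) R) (C : R) :=
  forall n k : nat, (k < 2 ^ n)%N ->
  forall x : circle R, @dyadic_interval R n k x ->
    ((C^-1 * 2 `^ birkhoff_sum phi n x)%:E <= nu (@dyadic_interval R n k)
      <= (C * 2 `^ birkhoff_sum phi n x)%:E)%E.

Section quasi_bernoulli.
Variable R : realType.
Local Notation S1 := (circle R).
Local Notation T := (@doubling R).
Variables (phi : S1 -> R) (nu : probability S1 R) (C : R).
Hypothesis inv : invariant_measure T nu.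
Hypothesis C0 : 0 < C.
Hypothesis gibbs : gibbs_bounds phi nu C.
Local Notation P := (prob nu).
(** The dyadic interval with index k at level n, as a level set of the index;
    it is empty when k >= 2^n. *)
Definition cyl n k : set S1 := [set x | code n x = k].

Lemma measurable_cyl n k : measurable (cyl n k).
Proof. exact: (measurable_code n (eq^~ k)). Qed.

Lemma gibbs_cyl n x :
  C^-1 * 2 `^ birkhoff_sum phi n x <= P (cyl n (code n x))
  <= C * 2 `^ birkhoff_sum phi n x.
Proof.
have := @gibbs n _ (code_lt n x) x; rewrite dyadic_intervalE ?code_lt // => /(_ erefl).
by rewrite (probE nu (measurable_cyl n (code n x))) !lee_fin.
Qed.

Lemma prob_iter n (A : set S1) : measurable A -> P (iter n T @^-1` A) = P A.
Proof.
elim: n A => [|n IH] A mA //=.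
rewrite -(IH A mA) {2}/prob -inv //.
  by congr (fine (nu _)); apply/seteqP; split=> x /=; rewrite -iterSr.
by rewrite -[X in measurable X]setTI; apply: measurable_iter.
Qed.

Lemma birkhoff_sumD n l x :
  birkhoff_sum phi (n + l) x = birkhoff_sum phi n x + birkhoff_sum phi l (iter n T x).
Proof.
rewrite /birkhoff_sum big_split_ord /=; congr (_ + _).
by apply: eq_bigr => i _; rewrite addnC iterD.
Qed.

(** The Birkhoff sum over n + l steps splits at time n, so that the Gibbs
    estimate for the long interval is a product of those for the two pieces,
    up to C^3. *)
Lemma cyl_quasi_bernoulli n l x :
  C^-1 ^+ 3 * P (cyl n (code n x)) * P (cyl l (code l (iter n T x))) <=
  P (cyl (n + l) (code (n + l) x)).
Proof.
have /andP[+ _] := gibbs_cyl (n + l) x; apply: le_trans.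
have /andP[_ h1] := gibbs_cyl n x.
have /andP[_ h2] := gibbs_cyl l (iter n T x).
rewrite birkhoff_sumD powRD; last by rewrite pnatr_eq0 implybT.
set a := 2 `^ _ in h1 *; set b := 2 `^ _ in h2 *.
have -> : C^-1 * (a * b) = C^-1 ^+ 3 * (C * a) * (C * b).
  by field; rewrite gt_eqF.
have C3 : 0 < C^-1 ^+ 3 by rewrite exprn_gt0 ?invr_gt0.
apply: ler_pM => //; rewrite ?prob_ge0 //; first by rewrite mulr_ge0 ?prob_ge0 // ltW.
by rewrite ler_pM2l.
Qed.

Lemma cylI n l k i : (i < 2 ^ l)%N ->
  cyl n k `&` iter n T @^-1` (cyl l i) = cyl (n + l) (k * 2 ^ l + i).
Proof.
move=> il; apply/seteqP; split=> x; rewrite /cyl /=.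
  by move=> [<- <-]; rewrite codeD.
by move/(codeDP _ _ _ il).
Qed.

(** Membership in U depends on the first n binary digits only: U is a union
    of dyadic intervals of level n. *)
Definition level n (U : set S1) := forall x y, code n x = code n y -> U x -> U y.

Lemma level_measurable n U : level n U -> measurable U.
Proof.
move=> lU; rewrite (_ : U = [set x | [set k | exists2 y, U y & code n y = k] (code n x)]).
  exact: measurable_code.
apply/seteqP; split=> x /=; first by exists x.
by move=> [y Uy E]; exact: (lU _ _ E).
Qed.

Lemma levelI_cyl n U k : level n U -> U `&` cyl n k = set0 \/ U `&` cyl n k = cyl n k.
Proof.
move=> lU; have [[x [Ux kx]]|nU] := pselect (exists x, (U `&` cyl n k) x).
  right; apply/seteqP; split=> [y []//|y ky]; split=> //.
  by apply: (lU x) => //; rewrite kx ky.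
by left; rewrite -subset0 => x Ux; apply: nU; exists x.
Qed.

Lemma levelS n m U : (n <= m)%N -> level n U -> level m U.
Proof.
move=> nm lU x y; rewrite -(subnKC nm) [code _ y]codeD => E; apply: lU.
by have [] := (codeDP n x (code n y) (code_lt _ _)).1 E.
Qed.

Lemma level_setI n U V : level n U -> level n V -> level n (U `&` V).
Proof. by move=> lU lV x y E [Ux Vx]; split; [exact: lU Ux|exact: lV Vx]. Qed.

Lemma level_setC n U : level n U -> level n (~` U).
Proof. by move=> lU x y E nUx Uy; apply: nUx; exact: lU Uy. Qed.

Lemma level_preimage n l D : level l D -> level (n + l) (iter n T @^-1` D).
Proof.
move=> lD x y; rewrite [code _ y]codeD => E; apply: lD.
by have [] := (codeDP n x (code n y) (code_lt _ _)).1 E.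
Qed.

Lemma level_cyl n k : level n (cyl n k).
Proof. by move=> x y E; rewrite /cyl /= E. Qed.

Arguments level_preimage n {l D} _.
Arguments level_cyl : clear implicits.

(** Quasi-independence of the first n digits from the following ones; this is
    the only mixing property that the proof needs. *)
Lemma level_quasi_bernoulli n l U D : level n U -> level l D ->
  C^-1 ^+ 3 * P U * P D <= P (U `&` iter n T @^-1` D).
Proof.
move=> lU lD.
have C3 : 0 < C^-1 ^+ 3 by rewrite exprn_gt0 ?invr_gt0.
have mU := level_measurable lU; have mD := level_measurable lD.
have mTD := level_measurable (level_preimage n lD).
have mUD := measurableI _ _ mU mTD.
rewrite (prob_partition nu mU (measurable_cyl n) (fun x _ => code_lt n x)).
rewrite (prob_partition nu mUD (measurable_cyl n) (fun x _ => code_lt n x)).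
rewrite mulr_sumr mulr_suml ler_sum // => k _.
have mUDk := measurableI _ _ mUD (measurable_cyl n k).
have mTl i : measurable [set x : S1 | code l (iter n T x) = i].
  exact: (level_measurable (level_preimage n (level_cyl l i))).
rewrite (prob_partition nu mUDk mTl (fun x _ => code_lt l (iter n T x))).
rewrite (prob_partition nu mD (measurable_cyl l) (fun x _ => code_lt l x)).
rewrite mulr_sumr ler_sum // => i _.
have -> : U `&` iter n T @^-1` D `&` cyl n k `&` [set x | code l (iter n T x) = i]
   = (U `&` cyl n k) `&` iter n T @^-1` (D `&` cyl l i).
  by rewrite preimage_setI setIACA setIA.
have [->|->] := levelI_cyl k lU; first by rewrite set0I prob0 mulr0 mul0r.
have [->|->] := levelI_cyl i lD; first by rewrite preimage_set0 setI0 prob0 mulr0.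
have il := ltn_ord i; have [x xk] := code_nonempty R (ltn_ord k).
have [y yi] := code_nonempty R il.
have kin : (k * 2 ^ l + i < 2 ^ (n + l))%N.
  by rewrite expnD -ltn_divLR ?expn_gt0// divnMDl ?expn_gt0// divn_small// addn0.
have [z zE] := code_nonempty R kin.
rewrite cylI // -zE; have [zk zi] := (codeDP _ _ _ il).1 zE.
by rewrite -zk -zi; exact: cyl_quasi_bernoulli.
Qed.

(** The event D j at time a j looks at the digits a j, ..., a j + l j - 1, and
    these blocks of digits are disjoint. The probability that the first k
    events all fail is at most that for independent trials of success
    probability C^-3 p. The first conjunct is needed by the induction. *)
Lemma prob_no_hit (a l : nat -> nat) (D : nat -> set S1) (p : R) (k : nat) :
  (forall j, (a j + l j <= a j.+1)%N) -> (forall j, level (l j) (D j)) ->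
  0 <= p -> (forall j, (j < k)%N -> p <= P (D j)) ->
  level (a k) [set x | forall j, (j < k)%N -> ~ D j (iter (a j) T x)] /\
  P [set x | forall j, (j < k)%N -> ~ D j (iter (a j) T x)] <=
    (1 - C^-1 ^+ 3 * p) ^+ k.
Proof.
move=> al lD p0; elim: k => [|k IH] pD.
  rewrite expr0; split=> //.
  by rewrite [X in P X](_ : _ = setT) ?probT // -subTset.
have C3 : 0 < C^-1 ^+ 3 by rewrite exprn_gt0 ?invr_gt0.
have [lU hU] := IH (fun j jk => pD j (ltnW jk)).
set U := [set x | _] in lU hU.
rewrite [X in level _ X](_ : _ = U `&` ~` (iter (a k) T @^-1` D k)); last first.
  apply/seteqP; split=> [x H|x [H1 H2] j]; first by split=> [j jk|]; apply: H => //; exact: ltnW.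
  by rewrite ltnS leq_eqVlt => /predU1P[->//|]; exact: H1.
rewrite [X in P X](_ : _ = U `&` ~` (iter (a k) T @^-1` D k)); last first.
  apply/seteqP; split=> [x H|x [H1 H2] j]; first by split=> [j jk|]; apply: H => //; exact: ltnW.
  by rewrite ltnS leq_eqVlt => /predU1P[->//|]; exact: H1.
have lTD := level_preimage (a k) (lD k).
split.
  apply: (levelS (al k)); apply: level_setI; last exact: level_setC.
  by apply: (levelS _ lU); exact: leq_addr.
have mU := level_measurable lU; have mD := level_measurable lTD.
have E := prob_setIC nu mU mD.
have Q := level_quasi_bernoulli lU (lD k).
have {}Q : C^-1 ^+ 3 * P U * p <= P (U `&` iter (a k) T @^-1` D k).
  by apply: le_trans Q; rewrite ler_wpM2l ?pD // mulr_ge0 ?prob_ge0 // ltW.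
rewrite exprSr.
have : P (U `&` ~` (iter (a k) T @^-1` D k)) <= P U * (1 - C^-1 ^+ 3 * p) by lra.
move=> H; apply: (le_trans H); apply: ler_wpM2r hU.
have lT : level 0 (@setT S1) by [].
have := level_quasi_bernoulli lT (lD k); rewrite probT mulr1 setTI /= subr_ge0.
have := prob_le1 nu (level_measurable (lD k)).
have := pD k (ltnSn k); nra.
Qed.
End quasi_bernoulli.

Arguments level_preimage {R} n {l D} _.
Arguments level_cyl R n k : clear implicits.

(** * Hoelder potentials *)

Section holder_potentials.
Variable R : realType.
Local Notation S1 := (circle R).
Local Notation proj := (\pi_(circle R) : R -> circle R).
Local Notation T := (@doubling R).
Variable phi : S1 -> R.
Hypothesis holder_phi : holder_continuous phi.

Lemma circle_dist_ge0 (x y : S1) : 0 <= circle_dist x y.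
Proof.
apply: lb_le_inf; last by move=> _ [t _ <-].
by exists `|fpart (x - y)|; exists (fpart (x - y)) => //=; rewrite fpartK.
Qed.

Lemma circle_dist_proj (s t : R) : circle_dist (proj s) (proj t) <= `|s - t|.
Proof.
apply: ge_inf; first by exists 0 => _ [u _ <-].
by exists (s - t) => //=; rewrite projB.
Qed.

(** The modulus of continuity, read on real lifts. *)
Lemma holder_proj : exists a K : R, [/\ 0 < a, a <= 1, 0 <= K &
  forall s t : R, `|phi (proj s) - phi (proj t)| <= K * `|s - t| `^ a].
Proof.
have [a [K [/andP[a0 a1] H]]] := holder_phi.
exists a, `|K|; split=> // s t; apply: (le_trans (H _ _)).
apply: (@le_trans _ _ (`|K| * circle_dist (proj s) (proj t) `^ a)).
  by rewrite ler_wpM2r ?powR_ge0 ?ler_norm.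
rewrite ler_wpM2l //; apply: ge0_ler_powR; rewrite ?nnegrE ?circle_dist_ge0 //.
  exact: ltW.
exact: circle_dist_proj.
Qed.

Lemma holder_proj_continuous : continuous (phi \o proj : R -> R).
Proof.
have [a [K [a0 a1 K0 H]]] := holder_proj.
move=> s; apply/cvgrPdist_lt => /= e e0.
have K1 : 0 < K + 1 by lra.
pose de := (e / (K + 1)) `^ a^-1.
have de0 : 0 < de by rewrite powR_gt0 // divr_gt0.
have deE : (K + 1) * de `^ a = e.
  by rewrite /de -powRrM mulVf ?gt_eqF // powRr1 ?divr_ge0 ?ltW //; field; rewrite gt_eqF.
near=> t; apply: (le_lt_trans (H _ _)).
have st : `|s - t| < de by near: t; exact: cvgr_dist_lt.
have : `|s - t| `^ a <= de `^ a.
  by apply: ge0_ler_powR; rewrite ?nnegrE // ltW.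
have : 0 < de `^ a by rewrite powR_gt0.
rewrite -deE; have := powR_ge0 `|s - t| a.
move: (`|s - t| `^ a) (de `^ a) => u v; nra.
Unshelve. all: by end_near. Qed.

Lemma holder_measurable : measurable_fun setT phi.
Proof.
rewrite (_ : phi = (phi \o proj) \o @fpart R).
  by apply: measurableT_comp; [exact: continuous_measurable_fun holder_proj_continuous
    |exact: measurable_fpart].
by apply/funext => x /=; rewrite fpartK.
Qed.

Lemma holder_bounded : exists2 B : R, 0 <= B & forall x, `|phi x| <= B.
Proof.
have [a [K [a0 a1 K0 H]]] := holder_proj.
exists (`|phi (proj 0)| + K) => [|x]; first by rewrite addr_ge0.
have := H (fpart x) 0; rewrite fpartK subr0 (ger0_norm (fpart_ge0 x)) => Hx.
have : fpart x `^ a <= 1.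
  have p1 : 1 `^ a = 1 :> R by rewrite powR1.
  rewrite -[leRHS]p1; apply: ge0_ler_powR; rewrite ?nnegrE ?fpart_ge0 ?ltW //.
  exact: fpart_lt1.
move: (fpart x `^ a) Hx => u Hx u1.
have := ler_normD (phi x - phi (proj 0)) (phi (proj 0)); rewrite subrK.
nra.
Qed.

(** Bounded distortion, also across the endpoints of dyadic intervals: at time
    j the lifts are at distance at most 2^(j - n), so the differences are
    dominated by a geometric series. *)
Lemma holder_distortion : exists2 K : R, 0 <= K & forall n (s t : R),
  `|s - t| <= 2 ^- n ->
  `|birkhoff_sum phi n (proj s) - birkhoff_sum phi n (proj t)| <= K.
Proof.
have [a [K [a0 a1 K0 H]]] := holder_proj.
(* q^n is the a-th power of 2^-n. *)
pose q : R := 2^-1 `^ a.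
have q0 : 0 < q by rewrite powR_gt0 // invr_gt0.
have q1 : q < 1.
  have p1 : 1 `^ a = 1 :> R by rewrite powR1.
  rewrite -[ltRHS]p1; apply: gt0_ltr_powR; rewrite ?nnegrE ?invr_ge0 //.
  by rewrite invf_lt1 ?ltr1n.
have qn n : (2 ^- n) `^ a = q ^+ n.
  rewrite -exprVn -[2^-1 ^+ n]powR_mulrn ?invr_ge0 // -powRrM mulrC powRrM.
  by rewrite powR_mulrn // ltW.
(* The truncated geometric series makes the induction exact. *)
suff S n (s t : R) : `|s - t| <= 2 ^- n ->
    `|birkhoff_sum phi n (proj s) - birkhoff_sum phi n (proj t)| <=
    K * (1 - q ^+ n.+1) / (1 - q).
  exists (K / (1 - q)) => [|n s t st]; first by rewrite divr_ge0 // subr_ge0 ltW.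
  apply: (le_trans (S n s t st)); rewrite ler_pM2r ?invr_gt0 ?subr_gt0 //.
  have : 0 <= q ^+ n.+1 by rewrite exprn_ge0 // ltW.
  move: (q ^+ _) => u; nra.
elim: n s t => [|n IH] s t st.
  rewrite /birkhoff_sum !big_ord0 subrr normr0 divr_ge0 ?mulr_ge0 // subr_ge0.
    by rewrite expr1 ltW.
  exact: ltW.
rewrite -[n.+1]add1n !birkhoff_sumD /birkhoff_sum !big_ord1 -/(birkhoff_sum phi n _)
  -/(birkhoff_sum phi n _) /= -[T (proj s)]/(iter 1 T (proj s))
  -[T (proj t)]/(iter 1 T (proj t)) !iter_doubling_proj expr1 add1n.
have st2 : `|2 * s - 2 * t| <= 2 ^- n.
  rewrite -mulrBr normrM ger0_norm // -ler_pdivlMl // mulrC.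
  by apply: le_trans st _; rewrite exprSr invfM.
have := IH _ _ st2; set X := _ - birkhoff_sum _ _ _ => HX.
have H1 := H s t.
have Hq : `|s - t| `^ a <= q ^+ n.+1.
  by rewrite -qn; apply: ge0_ler_powR; rewrite ?nnegrE ?invr_ge0 ?exprn_ge0 // ltW.
have : K * `|s - t| `^ a <= K * q ^+ n.+1 by rewrite ler_wpM2l.
have -> : K * (1 - q ^+ n.+2) / (1 - q) =
  K * q ^+ n.+1 + K * (1 - q ^+ n.+1) / (1 - q).
  by rewrite [q ^+ n.+2]exprSr; field; rewrite subr_eq0 gt_eqF.
move=> H2; rewrite opprD addrACA -/X.
by apply: (le_trans (ler_normD _ _)); apply: lerD => //; apply: (le_trans H1).
Qed.
End holder_potentials.

(** * Expectations of bounded functions *)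

Section bounded_measurable.
Context {d : measure_display} {T : measurableType d} {R : realType}.
Variable P : probability T R.
Implicit Types (f g : T -> R) (A : set T).

(** Bounded Borel functions, on which the expectation is finite and linear. *)
Definition bounded_measurable f :=
  measurable_fun setT f /\ exists B : R, forall x, `|f x| <= B.

Lemma bounded_measurable_cst c : bounded_measurable (cst c).
Proof. by split; [exact: measurable_cst|exists `|c|]. Qed.

Lemma bounded_measurableD f g : bounded_measurable f -> bounded_measurable g ->
  bounded_measurable (fun x => f x + g x).
Proof.
move=> [mf [B fB]] [mg [K gK]]; split; first exact: measurable_funD.
by exists (B + K) => x; apply: (le_trans (ler_normD _ _)); apply: lerD.
Qed.

Lemma bounded_measurableN f : bounded_measurable f -> bounded_measurable (fun x => - f x).
Proof.
move=> [mf [B fB]]; split; first exact: measurableT_comp.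
by exists B => x; rewrite normrN.
Qed.

Lemma bounded_measurableZ c f : bounded_measurable f ->
  bounded_measurable (fun x => c * f x).
Proof.
move=> [mf [B fB]]; split; first by apply: measurable_funM => //; exact: measurable_cst.
by exists (`|c| * B) => x; rewrite normrM ler_wpM2l.
Qed.

Lemma bounded_measurable_min f g : bounded_measurable f -> bounded_measurable g ->
  bounded_measurable (fun x => Num.min (f x) (g x)).
Proof.
move=> [mf [B fB]] [mg [K gK]]; split; first exact: measurable_minr.
exists (Num.max B K) => x; rewrite le_max; case: (leP (f x) (g x)) => _.
  by rewrite fB.
by rewrite gK orbT.
Qed.

Lemma bounded_measurable_comp f (h : T -> T) : bounded_measurable f ->
  measurable_fun setT h -> bounded_measurable (fun x => f (h x)).
Proof.
move=> [mf [B fB]] mh; split; first exact: (measurableT_comp mf mh).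
by exists B.
Qed.

Lemma bounded_measurable_indic A : measurable A -> bounded_measurable (\1_A : T -> R).
Proof.
move=> mA; split; first exact: measurable_indic.
by exists 1 => x; rewrite indicE; case: (_ \in _); rewrite ?normr0 ?normr1.
Qed.

Lemma bounded_measurable_sum n (F : 'I_n -> T -> R) :
  (forall i, bounded_measurable (F i)) -> bounded_measurable (fun x => \sum_(i < n) F i x).
Proof.
elim: n F => [|n IH] F bF.
  rewrite (_ : (fun x => _) = cst 0); first exact: bounded_measurable_cst.
  by apply/funext => x; rewrite big_ord0.
rewrite (_ : (fun x => _) = (fun x => (\sum_(i < n) F (widen_ord (leqnSn n) i) x) + F ord_max x)).
  by apply: bounded_measurableD => //; apply: IH.
by apply/funext => x; rewrite big_ord_recr.
Qed.

Lemma bounded_measurable_integrable f :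
  bounded_measurable f -> P.-integrable setT (EFin \o f).
Proof.
move=> [mf [B fB]]; apply: measurable_bounded_integrable => //.
  by apply: (le_lt_trans (probability_le1 P _)) => //; exact: ltry.
by exists B; split; rewrite ?num_real // => x mx z _; apply/ltW/(le_lt_trans _ mx).
Qed.

(** The expectation of a real function. *)
Definition expect f : R := \int[P]_x f x.

Lemma expectD f g : bounded_measurable f -> bounded_measurable g ->
  expect (fun x => f x + g x) = expect f + expect g.
Proof. by move=> bf bg; rewrite /expect RintegralD //; exact: bounded_measurable_integrable. Qed.

Lemma expectZ c f : bounded_measurable f -> expect (fun x => c * f x) = c * expect f.
Proof. by move=> bf; rewrite /expect RintegralZl //; exact: bounded_measurable_integrable. Qed.

Lemma expectN f : bounded_measurable f -> expect (fun x => - f x) = - expect f.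
Proof.
move=> bf; rewrite -mulN1r -expectZ //; congr expect; apply/funext => x.
by rewrite mulN1r.
Qed.

Lemma expect_cst c : expect (cst c) = c.
Proof. by rewrite /expect Rintegral_cst // -[fine _]/(prob P setT) probT mulr1. Qed.

Lemma expect_indic A : measurable A -> expect (\1_A : T -> R) = prob P A.
Proof. by move=> mA; rewrite /expect /Rintegral integral_indic // setIT. Qed.

Lemma expect_le f g : bounded_measurable f -> bounded_measurable g ->
  (forall x, f x <= g x) -> expect f <= expect g.
Proof.
by move=> bf bg fg; apply: le_Rintegral => //; exact: bounded_measurable_integrable.
Qed.

Lemma expect_sum n (F : 'I_n -> T -> R) : (forall i, bounded_measurable (F i)) ->
  expect (fun x => \sum_(i < n) F i x) = \sum_(i < n) expect (F i).
Proof.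
elim: n F => [|n IH] F bF.
  rewrite big_ord0 -[RHS](expect_cst 0); congr expect.
  by apply/funext => x; rewrite big_ord0.
rewrite big_ord_recr /= -IH // -expectD //; last exact: bounded_measurable_sum.
by congr expect; apply/funext => x; rewrite big_ord_recr.
Qed.

Lemma expectE f : bounded_measurable f -> (\int[P]_x (f x)%:E)%E = (expect f)%:E.
Proof.
move=> bf; rewrite /expect /Rintegral fineK //.
by apply: integrable_fin_num => //; exact: bounded_measurable_integrable.
Qed.

Lemma expect_invariant (h : T -> T) f : measurable_fun setT h -> invariant_measure h P ->
  bounded_measurable f -> expect (fun x => f (h x)) = expect f.
Proof.
move=> mh ih bf; have [mf _] := bf; rewrite /expect /Rintegral; congr fine.
transitivity (\int[pushforward P h]_y (f y)%:E)%E.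
  rewrite (integral_pushforward mh) //; first exact/measurable_EFinP.
  rewrite preimage_setT.
  exact: (bounded_measurable_integrable (bounded_measurable_comp bf mh)).
by apply: eq_measure_integral => A mA _; exact: ih.
Qed.

End bounded_measurable.

(** * The maximal ergodic inequality *)

Section maximal_ergodic.
Context {d : measure_display} {T : measurableType d} {R : realType}.
Variables (P : probability T R) (h : T -> T) (g : T -> R).
Hypotheses (mh : measurable_fun setT h) (ih : invariant_measure h P).
Hypothesis bg : bounded_measurable g.

(** The minimum of the partial sums over k steps, 0 <= k <= n, along the orbit
    of x. *)
Fixpoint min_sums (n : nat) (x : T) : R :=
  if n is m.+1 then Num.min 0 (g x + min_sums m (h x)) else 0.

Lemma bounded_measurable_min_sums n : bounded_measurable (min_sums n).
Proof.
elim: n => [|n IH]; first exact: bounded_measurable_cst.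
apply: bounded_measurable_min; first exact: bounded_measurable_cst.
by apply: bounded_measurableD => //; exact: bounded_measurable_comp.
Qed.

Lemma min_sums_le0 n x : min_sums n x <= 0.
Proof. by case: n => //= n; rewrite ge_min lexx. Qed.

Lemma min_sumsS n x : min_sums n.+1 x <= min_sums n x.
Proof.
elim: n x => [|n IH] x; first exact: min_sums_le0.
rewrite [leRHS]/= le_min min_sums_le0 /= ge_min; apply/orP; right.
by rewrite lerD2l; exact: IH.
Qed.

Lemma min_sums_le n x : min_sums n x <= \sum_(j < n) g (iter j h x).
Proof.
elim: n x => [|n IH] x; first by rewrite big_ord0.
rewrite big_ord_recl /= ge_min; apply/orP; right; rewrite lerD2l.
apply: (le_trans (IH _)); rewrite le_eqVlt; apply/orP; left; apply/eqP.
by apply: eq_bigr => j _; rewrite /bump -iterSr.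
Qed.

Lemma measurable_min_sums_ge0 n : measurable [set x | 0 <= min_sums n x].
Proof.
have [mm _] := bounded_measurable_min_sums n.
rewrite (_ : [set _ | _] = min_sums n @^-1` `[0, +oo[%classic).
  by rewrite -[X in measurable X]setTI; exact: mm.
by apply/seteqP; split=> x /=; rewrite in_itv /= andbT.
Qed.

(** Garsia's argument: g is at most the coboundary of [min_sums n] where the
    latter is negative; the coboundary is nonnegative elsewhere and has zero
    expectation. *)
Lemma min_sums_expect n B : (forall x, g x <= B) ->
  expect P g <= B * prob P [set x | 0 <= min_sums n x].
Proof.
move=> gB; set E := [set x | _].
have mE := measurable_min_sums_ge0 n.
have bM := bounded_measurable_min_sums n.
have bMh := bounded_measurable_comp bM mh.
have bE := bounded_measurableZ B (bounded_measurable_indic (R:=R) mE).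
rewrite -(expect_indic P mE) -expectZ; last exact: bounded_measurable_indic.
have bD := bounded_measurableD bM (bounded_measurableN bMh).
rewrite -[leRHS]add0r -[X in X + _](_ : expect P (fun x => min_sums n x - min_sums n (h x)) = 0).
  rewrite -expectD //; apply: expect_le => //; first exact: bounded_measurableD.
  move=> x; rewrite indicE.
  have h0 := min_sums_le0 n (h x).
  have [xE|xE] := boolP (x \in E).
    have {xE} : 0 <= min_sums n x by move/set_mem : xE.
    have := min_sums_le0 n x; have := gB x; rewrite mulr1; lra.
  have {xE} : min_sums n x < 0 by rewrite ltNge; apply: contra xE => H; exact: mem_set.
  case: (n) h0 => [|m] h0 /=; first by rewrite ltxx.
  rewrite mulr0 addr0 gt_min ltxx /= => H.
  by rewrite (min_r (ltW H)) -addrA lerDl subr_ge0; exact: (min_sumsS m (h x)).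
rewrite expectD //; last exact: bounded_measurableN.
by rewrite expectN // (expect_invariant mh ih bM) subrr.
Qed.

Lemma measurable_sums_ge0 :
  measurable [set x | forall n, 0 <= \sum_(j < n) g (iter j h x)].
Proof.
rewrite (_ : [set _ | _] = \bigcap_n [set x | 0 <= \sum_(j < n) g (iter j h x)]); last first.
  by apply/seteqP; split=> [x H' n _|x H' n]; [exact: H'|exact: (H' n I)].
apply: bigcapT_measurable => n.
have [mS _] : bounded_measurable (fun x => \sum_(j < n) g (iter j h x)).
  apply: bounded_measurable_sum => i; apply: bounded_measurable_comp => //.
  by elim: (nat_of_ord i) => [|m IH]; [exact: measurable_id|exact: (measurableT_comp mh IH)].
rewrite (_ : [set _ | _] = (fun x => \sum_(j < n) g (iter j h x)) @^-1` `[0, +oo[%classic).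
  by rewrite -[X in measurable X]setTI; exact: mS.
by apply/seteqP; split=> x /=; rewrite in_itv /= andbT.
Qed.

(** If g has positive mean, then with positive probability all partial sums of
    g along the orbit are nonnegative. *)
Lemma maximal_ergodic : 0 < expect P g ->
  0 < prob P [set x | forall n, 0 <= \sum_(j < n) g (iter j h x)].
Proof.
move=> g0.
have [_ [B gB]] := bg.
have {gB} gB x : g x <= `|B| + 1.
  by rewrite (le_trans (ler_norm _)) // (le_trans (gB x)) // (le_trans (ler_norm B)) // lerDl.
have B0 : 0 < `|B| + 1 by rewrite ltr_wpDl.
pose F n := [set x | 0 <= min_sums n x].
have mF n : measurable (F n) := measurable_min_sums_ge0 n.
have mcap : measurable (\bigcap_n F n) by exact: bigcapT_measurable.
have FE n : ((expect P g / (`|B| + 1))%:E <= P (F n))%E.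
  rewrite (probE P (mF n)) lee_fin ler_pdivrMr // mulrC; exact: min_sums_expect.
have cF : P \o F @ \oo --> P (\bigcap_n F n).
  apply: nonincreasing_cvg_mu => //.
    by apply: (le_lt_trans (probability_le1 P _)) => //; exact: ltry.
  apply/nonincreasing_seqP => n; apply/subsetPset => x /=.
  by rewrite /F /= => H; exact: (le_trans H (min_sumsS n x)).
have : ((expect P g / (`|B| + 1))%:E <= P (\bigcap_n F n))%E.
  rewrite -(cvg_lim _ cF) //; apply: lime_ge; first by apply/cvg_ex; eexists; exact: cF.
  by apply: nearW => n; exact: FE.
rewrite (probE P mcap) lee_fin => H.
apply: (lt_le_trans (divr_gt0 g0 B0)); apply: (le_trans H).
apply: prob_le => //; last first.
  by move=> x Fx n; apply: le_trans (min_sums_le n x); exact: Fx.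
exact: measurable_sums_ge0.
Qed.

End maximal_ergodic.

(** * Decay of Gibbs measures *)

Section gibbs_decay.
Variable R : realType.
Local Notation S1 := (circle R).
Local Notation T := (@doubling R).
Variables (phi : S1 -> R) (nu : probability S1 R) (C B : R).
Hypothesis inv : invariant_measure T nu.
Hypothesis C0 : 0 < C.
Hypothesis gibbs : gibbs_bounds phi nu C.
Hypothesis phiB : forall x, `|phi x| <= B.
Hypothesis mphi : measurable_fun setT phi.
Local Notation P := (prob nu).

Lemma birkhoff_sum_ge n (x : S1) : - (B * n%:R) <= birkhoff_sum phi n x.
Proof.
have -> : - (B * n%:R) = \sum_(i < n) - B by rewrite sumr_const card_ord -[RHS]mulr_natr mulNr.
by apply: ler_sum => i _; have := phiB (iter i T x); rewrite ler_norml => /andP[].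
Qed.

Lemma cyl_ge n (x : S1) : C^-1 * 2 `^ (- (B * n%:R)) <= P (cyl n (code n x)).
Proof.
have /andP[+ _] := gibbs_cyl gibbs n x; apply: le_trans.
by rewrite ler_pM2l ?invr_gt0 // pow2_le birkhoff_sum_ge.
Qed.

(** Dyadic intervals have uniformly exponentially small measure: a point with
    given first n digits avoids, n times in a row, the opposite digit. *)
Lemma cyl_decay : exists theta : R, [/\ 0 <= theta, theta < 1 &
  forall n (x : S1), P (cyl n (code n x)) <= theta ^+ n].
Proof.
pose p := C^-1 * 2 `^ (- (B * 1%:R)).
have p0 : 0 < p by rewrite mulr_gt0 ?invr_gt0 ?powR_gt0.
have D n (x : S1) : P (cyl n (code n x)) <= (1 - C^-1 ^+ 3 * p) ^+ n.
  (* D j: the digit at time j differs from that of x. *)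
  pose D j : set S1 := cyl 1 (1 - code 1 (iter j T x)).
  have lD j : level 1 (D j) by exact: level_cyl.
  have pD j : (j < n)%N -> p <= P (D j).
    move=> _; have [|y yE] := @code_nonempty R 1 (1 - code 1 (iter j T x)).
      by have := code_lt 1 (iter j T x); lia.
    by rewrite /D -yE; exact: (cyl_ge 1 y).
  have [] := prob_no_hit C0 gibbs (a := id) (l := fun=> 1%N) (D := D) _ lD (ltW p0) pD.
    by move=> j; rewrite addn1.
  move=> lU; apply: le_trans; apply: prob_le; [exact: measurable_cyl|exact: level_measurable lU|].
  move=> y yx j jn; rewrite /D /cyl /= => E.
  have lj := level_preimage j (level_cyl R 1 (code 1 (iter j T x))).
  have /(_ x y (esym yx) erefl) : level n (iter j T @^-1` cyl 1 (code 1 (iter j T x))).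
    by apply: levelS lj; rewrite addn1.
  by rewrite /cyl /= E; have := code_lt 1 (iter j T x); lia.
exists (1 - C^-1 ^+ 3 * p); split=> //.
  by have := D 1%N 0; rewrite expr1; apply: le_trans; exact: prob_ge0.
by rewrite ltrBlDr ltrDl mulr_gt0 // exprn_gt0 ?invr_gt0.
Qed.

Lemma expect_birkhoff (mu : probability S1 R) n : invariant_measure T mu ->
  expect mu (birkhoff_sum phi n) = n%:R * expect mu phi.
Proof.
move=> imu; have bphi : bounded_measurable phi by split=> //; exists B.
have mi := @measurable_iter R.
rewrite /birkhoff_sum expect_sum; last first.
  by move=> i; exact: bounded_measurable_comp.
rewrite (eq_bigr (fun=> expect mu phi)); last first.
  move=> i _; apply: expect_invariant => //; move=> A mA.
  have mA' : measurable (iter i T @^-1` A) by rewrite -[X in measurable X]setTI; exact: mi.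
  by rewrite !probE // prob_iter.
by rewrite sumr_const card_ord -[LHS]mulr_natl.
Qed.

End gibbs_decay.

(** * Typical points of the second measure *)

Section typical_points.
Variable R : realType.
Local Notation S1 := (circle R).
Local Notation T := (@doubling R).
Variables (phi psi : S1 -> R) (mu nu : probability S1 R) (C K B : R).
Hypothesis inv_nu : invariant_measure T nu.
Hypotheses (C0 : 0 < C) (K0 : 0 < K).
Hypothesis gibbs_mu : gibbs_bounds phi mu C.
Hypothesis gibbs_nu : gibbs_bounds psi nu K.
Hypothesis phiB : forall x, `|phi x| <= B.
Hypothesis mphi : measurable_fun setT phi.
Local Notation alpha := (expect nu (fun x => - phi x)).

Let bphi : bounded_measurable phi. Proof. by split=> //; exists B. Qed.

Let alphaE n : expect nu (fun x => - birkhoff_sum phi n x) = n%:R * alpha.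
Proof.
have bS : bounded_measurable (birkhoff_sum phi n).
  apply: bounded_measurable_sum => i; apply: bounded_measurable_comp => //.
  exact: measurable_iter.
by rewrite !expectN // (expect_birkhoff phiB) // mulrN.
Qed.

Let bSN n : bounded_measurable (fun x => - birkhoff_sum phi n x).
Proof.
apply: bounded_measurableN.
by apply: bounded_measurable_sum => i; apply: bounded_measurable_comp => //; exact: measurable_iter.
Qed.

(** By the uniform decay, some Birkhoff sum of phi is at most -1 everywhere. *)
Lemma energy_gt0 : 0 < alpha.
Proof.
have [theta [t0 t1 H]] := cyl_decay C0 gibbs_mu phiB.
have e0 : 0 < (2 * C)^-1 by rewrite invr_gt0 mulr_gt0.
have [n nE] := expr_small t0 t1 e0.
have S1 x : 1 <= - birkhoff_sum phi n x.
  rewrite lerNr -pow2_le powRN powRr1 //.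
  have /andP[H1 _] := gibbs_cyl gibbs_mu n x.
  have := le_trans H1 (le_trans (H n x) (ltW nE)).
  by rewrite invfM mulrC ler_pM2r ?invr_gt0.
have : 1 <= n%:R * alpha.
  rewrite -alphaE -[leLHS](expect_cst nu); apply: expect_le => //.
  exact: bounded_measurable_cst.
move=> H1; case: (ltP 0 alpha) => // a0.
have : n%:R * alpha <= 0 by rewrite mulr_ge0_le0.
lra.
Qed.

(** Markov's inequality: minus the Birkhoff sum of phi over m steps has mean
    alpha m and is bounded below independently of m. So it is at most about
    b m with a probability bounded away from 0, and then the Gibbs estimate
    bounds the mu-measure of the dyadic interval from below. *)
Lemma prob_large_cyl (b : R) : alpha < b -> exists (delta : R) (m0 : nat), 0 < delta /\
  forall m, (m0 <= m)%N ->
  delta <= prob nu [set x | 2 `^ (- (b * m%:R)) <= prob mu (cyl m (code m x))].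
Proof.
move=> ab; have a0 := energy_gt0; have b0 : 0 < b by lra.
have [L L0 CL] := le_pow2 C0.
pose m0 := (Num.truncn (2 * L / (b - alpha))).+1.
exists ((b - alpha) / (2 * b)), m0; split; first by rewrite divr_gt0 // ?subr_gt0 ?mulr_gt0.
move=> m mm0; set D := [set x | _].
have mD : measurable D.
  exact: (measurable_code m [set k | 2 `^ (- (b * m%:R)) <= prob mu (cyl m k)]).
have mDC := measurableC mD.
have Lm : 2 * L <= (b - alpha) * m%:R.
  rewrite -ler_pdivrMl ?subr_gt0 // mulrC ltW //.
  by apply: (lt_le_trans (truncnS_gt _)); rewrite ler_nat.
have H1 x : b * m%:R * \1_(~` D) x + - L <= - birkhoff_sum phi m x.
  have /andP[G _] := gibbs_cyl gibbs_mu m x.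
  have {G} G : 2 `^ birkhoff_sum phi m x <= 2 `^ L * prob mu (cyl m (code m x)).
    apply: (@le_trans _ _ (C * prob mu (cyl m (code m x)))); first by rewrite -ler_pdivrMl.
    by rewrite ler_wpM2r ?prob_ge0.
  rewrite indicE; have [xD|xD] := boolP (x \in ~` D).
    move/set_mem : xD => /= /negP; rewrite -ltNge => /ltW xD.
    suff : birkhoff_sum phi m x <= L + - (b * m%:R) by rewrite mulr1; lra.
    rewrite -pow2_le powRD; last by rewrite pnatr_eq0 implybT.
    by apply: (le_trans G); rewrite ler_wpM2l ?powR_ge0.
  suff : birkhoff_sum phi m x <= L by rewrite mulr0; lra.
  rewrite -pow2_le; apply: (le_trans G); rewrite ler_piMr ?powR_ge0 //.
  by apply: prob_le1; exact: measurable_cyl.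
have b1 := bounded_measurable_indic (R := R) mDC.
have b2 := bounded_measurableZ (b * m%:R) b1.
have b3 := bounded_measurableD b2 (bounded_measurable_cst (T := S1) (- L)).
have := expect_le nu b3 (bSN m) H1.
rewrite alphaE expectD //; last exact: bounded_measurable_cst.
rewrite expectZ // expect_indic // probC // expect_cst => H.
have m1 : 0 < m%:R :> R by rewrite ltr0n; exact: leq_trans mm0.
rewrite ler_pdivrMr ?mulr_gt0 // -(ler_pM2r m1).
nra.
Qed.

(** Almost every point has, at some scale m beyond any given one, a dyadic
    neighbourhood of mu-measure at least 2^(- b m). A success for the digits after time N at a
    scale m much larger than N is a success for the point itself at scale
    N + m, so that infinitely many quasi-independent trials are available. *)
Lemma infinitely_many_large_cyl (b : R) : alpha < b -> forall N0 : nat,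
  prob nu (~` [set x | exists2 m, (N0 <= m)%N &
    2 `^ (- (b * m%:R)) <= prob mu (cyl m (code m x))]) = 0.
Proof.
(* The gap between b' and b pays for the first N digits. *)
move=> ab N0; pose b' := (alpha + b) / 2.
have ab' : alpha < b' by rewrite /b'; lra.
have bb' : b' < b by rewrite /b'; lra.
have a0 := energy_gt0; have B0 : 0 <= B by exact: le_trans (normr_ge0 _) (phiB 0).
have [L L0 CL] := le_pow2 C0.
have [delta [m0 [d0 Hd]]] := prob_large_cyl ab'.
(* mm N: a scale at which the first N digits and the constants cost at most
   a factor 2^((b - b') (mm N)). *)
pose mm (N : nat) := (m0 + (Num.truncn ((4 * L + B * N%:R) / (b - b'))).+1)%N.
have mmE N : 4 * L + B * N%:R <= (b - b') * (mm N)%:R.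
  rewrite -ler_pdivrMl ?subr_gt0 // mulrC ltW //.
  by apply: (lt_le_trans (truncnS_gt _)); rewrite ler_nat leq_addl.
(* The k-th trial uses the mm (a k) digits that follow the first a k ones. *)
pose a := fix a k := if k is j.+1 then (a j + mm (a j))%N else N0.
pose D k := [set x : S1 | 2 `^ (- (b' * (mm (a k))%:R)) <=
  prob mu (cyl (mm (a k)) (code (mm (a k)) x))].
have aN k : (N0 <= a k)%N by elim: k => //= k IH; exact: leq_trans (leq_addr _ _).
have step k x : D k (iter (a k) T x) ->
  2 `^ (- (b * (a k + mm (a k))%:R)) <= prob mu (cyl (a k + mm (a k)) (code (a k + mm (a k)) x)).
  rewrite /D /= => Dx; apply: le_trans (cyl_quasi_bernoulli C0 gibbs_mu _ _ _).
  have H1 := cyl_ge C0 gibbs_mu phiB (a k) x.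
  have CV : 2 `^ (- L) <= C^-1 by rewrite powRN lef_pV2 // posrE ?powR_gt0.
  have H3 : 2 `^ (- L) ^+ 4 * 2 `^ (- (B * (a k)%:R)) * 2 `^ (- (b' * (mm (a k))%:R)) <=
    C^-1 ^+ 3 * prob mu (cyl (a k) (code (a k) x)) *
      prob mu (cyl (mm (a k)) (code (mm (a k)) (iter (a k) T x))).
    apply: ler_pM => //; rewrite ?mulr_ge0 ?exprn_ge0 ?powR_ge0 //.
    rewrite exprSr -mulrA; apply: ler_pM; rewrite ?mulr_ge0 ?exprn_ge0 ?powR_ge0 //.
      by apply: lerXn2r; rewrite ?nnegrE ?powR_ge0 ?invr_ge0 // ltW.
    apply: (le_trans _ H1); apply: ler_wpM2r => //; exact: powR_ge0.
  apply: (le_trans _ H3).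
  rewrite -powR_mulrn ?powR_ge0 // -powRrM -!powRD; try by rewrite pnatr_eq0 implybT.
  rewrite pow2_le natrD; have := mmE (a k).
  have : 0 <= b * (a k)%:R by rewrite mulr_ge0 // ltW //; lra.
  by lra.
apply: (@le_expr_eq0 _ _ (1 - K^-1 ^+ 3 * delta)); first exact: prob_ge0.
  by rewrite ltrBlDr ltrDl mulr_gt0 // exprn_gt0 ?invr_gt0.
move=> k.
have [] := prob_no_hit K0 gibbs_nu (a := a) (l := fun j => mm (a j)) (D := D) (p := delta) (k := k).
- by move=> j; rewrite leqnn.
- by move=> j x y E; rewrite /D /= E.
- exact: ltW.
- by move=> j _; apply: Hd; exact: leq_addr.
move=> lU; apply: le_trans; apply: prob_le.
- apply: measurableC.
  rewrite (_ : [set _ | _] = \bigcup_(m in [set m | (N0 <= m)%N])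
    [set x | 2 `^ (- (b * m%:R)) <= prob mu (cyl m (code m x))]).
    apply: bigcup_measurable => m _.
    exact: (measurable_code m [set k | 2 `^ (- (b * m%:R)) <= prob mu (cyl m k)]).
  by apply/seteqP; split=> x [m] *; exists m.
- exact: level_measurable lU.
move=> x nx j _ /step Dx; apply: nx; exists (a j + mm (a j))%N => //.
exact: leq_trans (aN j) (leq_addr _ _).
Qed.

End typical_points.

(** * Targets that are hit infinitely often *)

Section targets.
Variable R : realType.
Local Notation S1 := (circle R).
Local Notation proj := (\pi_(circle R) : R -> circle R).
Local Notation T := (@doubling R).

(** The open ball of radius r around x: the points y such that x - y has a real
    lift of absolute value less than r. *)
Definition circle_ball (x : S1) (r : R) : set S1 :=
  [set y | exists2 t : R, `|t| < r & proj (fpart x - fpart y) = proj t].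

Lemma target_intervalE kappa n (s x : S1) : target_interval kappa n s x <->
  circle_ball x (n%:R `^ (- kappa)) (iter n T s).
Proof.
split=> [[t]|[t]] /=; rewrite ?in_itv /= -?ltr_norml.
  move=> ht <-; exists t => //; rewrite projB !fpartK.
  by rewrite addrAC subrr add0r.
move=> ht E; exists t; first by rewrite /= in_itv /= -ltr_norml.
by rewrite -E projB !fpartK addrC subrK.
Qed.

Lemma measurable_target kappa n :
  measurable [set p : S1 * S1 | target_interval kappa n p.1 p.2].
Proof.
pose r : R := n%:R `^ (- kappa).
pose g (p : S1 * S1) : R := fpart p.2 - fpart (iter n T p.1).
have mg : measurable_fun setT g.
  apply: measurable_funB; apply: measurableT_comp; try exact: measurable_fpart.
    exact: measurable_snd.
  by apply: measurableT_comp; [exact: measurable_iter|exact: measurable_fst].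
rewrite (_ : [set _ | _] = g @^-1` (proj @^-1` (proj @` `]-r, r[%classic))).
  rewrite -[X in measurable X]setTI; apply: mg => //; apply: open_measurable.
  by apply: open_proj_preimage; apply: open_proj_image; exact: interval_open.
apply/seteqP; split=> -[s x] /=; rewrite target_intervalE.
  by move=> [t ht E]; exists t => //=; rewrite in_itv /= -ltr_norml.
by move=> [t]; rewrite /= in_itv /= -ltr_norml => ht E; exists t.
Qed.

Lemma target_code kappa n m (s x : S1) : 2 ^- m <= n%:R `^ (- kappa) ->
  code m (iter n T s) = code m x -> target_interval kappa n s x.
Proof.
move=> mn E; apply/target_intervalE; exists (fpart x - fpart (iter n T s)) => //.
apply: lt_le_trans mn.
have m0 : (0 : R) < 2 ^+ m by rewrite exprn_gt0.
rewrite -(ltr_pM2r m0) mulVf ?gt_eqF // -{1}(ger0_norm (ltW m0)) -normrM.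
have := code_itv m x; have := code_itv m (iter n T s).
rewrite E -[(code m x).+1%:R]natr1.
by rewrite mulrBl ![_ * 2 ^+ m]mulrC ltr_norml => /andP[? ?] /andP[? ?]; apply/andP; split; lra.
Qed.

Section shrinking_targets_hit.
Variables (phi : S1 -> R) (nu : probability S1 R) (C kappa b : R) (x : S1).
Hypothesis C0 : 0 < C.
Hypothesis gibbs : gibbs_bounds phi nu C.
Hypotheses (kappa0 : 0 < kappa) (b0 : 0 < b) (kb : kappa * b < 1).
Hypothesis large : forall N0 : nat, exists2 m, (N0 <= m)%N &
  2 `^ (- (b * m%:R)) <= prob nu (cyl m (code m x)).

(** When x has nu-large dyadic neighbourhoods at infinitely many scales m, the
    times N m, (N + 1) m, ... up to 2^(m / kappa) are quasi-independent trials
    to come within 2^-m of x. There are about 2^(m / kappa) / m of them, each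
    of success probability at least of order 2^(- b m). *)
Lemma target_hit N : measurable [set s | forall n, (N <= n)%N -> ~ target_interval kappa n s x] ->
 (0 < N)%N ->
  prob nu [set s | forall n, (N <= n)%N -> ~ target_interval kappa n s x] = 0.
Proof.
set A := [set s | _] => mA N0; apply/eqP; rewrite eq_le prob_ge0 andbT leNgt.
apply/negP => A0.
pose c := C^-1 ^+ 3; have c0 : 0 < c by rewrite exprn_gt0 ?invr_gt0.
pose g := kappa^-1 - b.
have g0 : 0 < g by rewrite subr_gt0 -[b]mul1r -ltr_pdivlMr // -invfM  invf_gt1 ?mulr_gt0 // mulrC.
pose la := g * ln 2 / 2.
have la0 : 0 < la by rewrite !mulr_gt0 ?invr_gt0 // ln_gt0 // ltr1n.
(* Large enough for the block of times below to contain at least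
   (prob nu A)^-1 / p trials of success probability p. *)
pose m0 := (Num.truncn (((prob nu A)^-1 / c + 1 + N%:R) / la ^+ 2)).+1.
have [m mm0 Hm] := large m0.
have m1 : (0 < m)%N by exact: leq_trans mm0.
have mR : 0 < m%:R :> R by rewrite ltr0n.
have Hla : (prob nu A)^-1 / c + 1 + N%:R < la ^+ 2 * m%:R.
  rewrite -ltr_pdivrMl ?exprn_gt0 // mulrC.
  by apply: (lt_le_trans (truncnS_gt _)); rewrite ler_nat.
pose W := 2 `^ (kappa^-1 * m%:R) / m%:R.
have W0 : 0 <= W by rewrite divr_ge0 ?powR_ge0.
(* The times (N + i) m, for i < k, lie between N m and 2^(m / kappa). *)
pose k := (Num.truncn W - N)%N.
pose p := c * 2 `^ (- (b * m%:R)).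
have p0 : 0 < p by rewrite mulr_gt0 ?powR_gt0.
pose D := fun _ : nat => cyl m (code m x) : set S1.
have al i : ((N + i) * m + m <= (N + i.+1) * m)%N by rewrite addnS mulSn addnC.
have aux j : prob nu [set s | forall i, (i < j)%N ->
    ~ D i (iter ((N + i) * m) T s)] <= (1 - p) ^+ j.
  by have [] := prob_no_hit C0 gibbs (a := fun i => ((N + i) * m)%N) (l := fun=> m) (D := D)
    (p := 2 `^ (- (b * m%:R))) (k := j) al
    (fun i => level_cyl R m (code m x)) (powR_ge0 _ _) (fun _ _ => Hm).
have p1 : p <= 1.
  rewrite -subr_ge0; have := aux 1%N; rewrite expr1; apply: le_trans; exact: prob_ge0.
have Ak : prob nu A <= (1 - p) ^+ k.
  apply: le_trans (aux k); apply: prob_le => //.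
    have [+ _] := prob_no_hit C0 gibbs (a := fun i => ((N + i) * m)%N) (l := fun=> m) (D := D)
      (p := 0) (k := k) al (fun i => level_cyl R m (code m x)) (lexx _) (fun _ _ => prob_ge0 _ _).
    exact: level_measurable.
  move=> s As i ik Di; apply: (As ((N + i) * m)%N).
    by rewrite -[leqLHS]muln1 leq_mul ?leq_addr.
  apply: target_code Di.
  have n0 : (0 < (N + i) * m)%N by rewrite muln_gt0 m1 addn_gt0 N0.
  have : ((N + i) * m)%:R <= 2 `^ (kappa^-1 * m%:R).
    rewrite natrM -ler_pdivlMr // -/W -truncn_ge_nat //.
    by move: ik; rewrite /k ltn_subRL => /ltnW.
  move=> H.
  have {}H : ((N + i) * m)%:R `^ kappa <= 2 ^+ m :> R.
    have -> : 2 ^+ m = 2 `^ (kappa^-1 * m%:R) `^ kappa.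
      by rewrite -powRrM mulrAC mulVf ?gt_eqF // mul1r powR_mulrn.
    by apply: ge0_ler_powR; rewrite ?nnegrE ?powR_ge0 ?(ltW kappa0) ?ler0n.
  have q0 : 0 < ((N + i) * m)%:R `^ kappa :> R by rewrite powR_gt0 // ltr0n.
  by rewrite powRN lef_pV2 // posrE exprn_gt0.
have Hk : (prob nu A)^-1 <= k%:R * p.
  have h1 : W < (Num.truncn W)%:R + 1 by rewrite natr1 truncnS_gt.
  have h2 : (Num.truncn W)%:R <= k%:R + N%:R :> R.
    by rewrite -natrD ler_nat /k addnC -leq_subLR.
  have P1 : 2 `^ (- (b * m%:R)) <= 1 :> R.
    by rewrite -[leRHS](powRr0 2) pow2_le oppr_le0 mulr_ge0 // ltW.
  have P0 : 0 <= 2 `^ (- (b * m%:R)) :> R by exact: powR_ge0.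
  have WE : la ^+ 2 * m%:R <= W * 2 `^ (- (b * m%:R)).
    rewrite /W [leRHS]mulrAC -powRD ?pnatr_eq0 ?implybT // ler_pdivlMr //.
    have -> : kappa^-1 * m%:R - b * m%:R = g * m%:R by rewrite /g; ring.
    have := pow2_ge (ltW g0) (ltW mR); rewrite -/la; apply: le_trans.
    by rewrite [(la * _) ^+ 2]exprMn -mulrA -expr2.
  have H1 := number_of_trials h1 h2 P0 P1 (ler0n R N) WE Hla.
  by rewrite /p mulrCA mulrC -ler_pdivrMr.
have H1 : 1 < prob nu A * (1 + k%:R * p).
  have : prob nu A * (prob nu A)^-1 <= prob nu A * (k%:R * p) by rewrite ler_pM2l.
  by rewrite mulfV ?gt_eqF // mulrDr mulr1; by move=> h; apply: (le_lt_trans h); rewrite ltrDr.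
have Hle : prob nu A * (1 + k%:R * p) <= (1 - p) ^+ k * (1 + k%:R * p).
  by rewrite ler_wpM2r // addr_ge0 // mulr_ge0 // ltW.
by have := lt_le_trans H1 (le_trans Hle (bernoulli_inverse k (ltW p0) p1)); rewrite ltxx.
Qed.

End shrinking_targets_hit.
End targets.

(** * Gibbs measure of small balls *)

Section ball_measure.
Variable R : realType.
Local Notation S1 := (circle R).
Local Notation proj := (\pi_(circle R) : R -> circle R).
Local Notation T := (@doubling R).

Lemma code_proj m (v : R) : 0 <= v ->
  code m (proj v) = (Num.truncn (2 ^+ m * v) %% 2 ^ m)%N.
Proof.
move=> v0; have /proj_eqP[z Ez] : proj v = proj (fpart (proj v)) by rewrite fpartK.
have z0 : (0 <= z)%R.
  have : (-1)%:~R < (z%:~R : R).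
    have := fpart_lt1 (proj v); rewrite mulrNz; lra.
  by rewrite ltr_int; lia.
case: z Ez z0 => // z Ez _.
have /andP[h1 h2] := code_itv m (proj v).
have -> : Num.truncn (2 ^+ m * v) = (z * 2 ^ m + code m (proj v))%N.
  have -> : 2 ^+ m * v = 2 ^+ m * fpart (proj v) + (z * 2 ^ m)%:R.
    by rewrite {1}Ez natrM natrX -pmulrn; ring.
  move: (2 ^+ m * fpart (proj v)) (code m (proj v)) h1 h2 => w q h1 h2 {Ez}.
  by apply: truncn_def; rewrite -addnS !natrD; apply/andP; split; lra.
by rewrite modnMDl modn_small // code_lt.
Qed.

Variables (phi : S1 -> R) (nu : probability S1 R) (C K : R).
Hypothesis C0 : 0 < C.
Hypothesis gibbs : gibbs_bounds phi nu C.
Hypothesis distortion : forall n (s t : R), `|s - t| <= 2 ^- n ->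
  `|birkhoff_sum phi n (proj s) - birkhoff_sum phi n (proj t)| <= K.
Local Notation P := (prob nu).

Lemma measurable_circle_ball (x : S1) r : measurable (circle_ball x r).
Proof.
rewrite (_ : circle_ball x r = (fun y => fpart x - fpart y) @^-1`
    (proj @^-1` (proj @` `]-r, r[%classic))).
  have mf : measurable_fun setT (fun y : S1 => fpart x - fpart y).
    by apply: measurable_funB; [exact: measurable_cst|exact: measurable_fpart].
  rewrite -[X in measurable X]setTI; apply: mf => //; apply: open_measurable.
  by apply: open_proj_preimage; apply: open_proj_image; exact: interval_open.
apply/seteqP; split=> y /= [t].
  by move=> ht E; exists t => //=; rewrite in_itv /= -ltr_norml.
by rewrite /= in_itv /= -ltr_norml => ht E; exists t.
Qed.

Lemma circle_ball_lift (x y : S1) r : circle_ball x r y ->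
  exists2 t : R, `|t| < r & y = proj (fpart x + t).
Proof.
move=> [t ht]; rewrite projB !fpartK => E; exists (- t); first by rewrite normrN.
by rewrite projB -E fpartK subKr.
Qed.

Lemma ball_cyl_le m x i : P (circle_ball x (2 ^- m) `&` cyl m i) <=
  C * 2 `^ (birkhoff_sum phi m x + K).
Proof.
have [[y [By yi]]|nE] := pselect (exists y, (circle_ball x (2 ^- m) `&` cyl m i) y); last first.
  rewrite (_ : _ `&` _ = set0) ?prob0 ?mulr_ge0 ?powR_ge0 ?ltW //.
  by rewrite -subset0 => y Hy; apply: nE; exists y.
have [t ht Ey] := circle_ball_lift By.
have mC := @measurable_cyl R m i.
apply: (@le_trans _ _ (P (cyl m i))).
  by apply: prob_le => //; apply: measurableI => //; exact: measurable_circle_ball.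
have /andP[_ H] := gibbs_cyl gibbs m y.
move: yi H; rewrite /cyl /= => -> H; apply: (le_trans H).
rewrite ler_pM2l // pow2_le.
have := distortion (n := m) (s := fpart x + t) (t := fpart x).
rewrite addrAC subrr add0r => /(_ (ltW ht)); rewrite -Ey fpartK ler_norml => /andP[_].
by rewrite lerBlDl.
Qed.

(** A ball of radius 2^-m meets at most three dyadic intervals of level m; the
    Gibbs estimate on each of them is comparable to the one at x by bounded
    distortion. *)
Lemma ball_le m x : P (circle_ball x (2 ^- m)) <=
  3 * (C * 2 `^ (birkhoff_sum phi m x + K)).
Proof.
set Bx := circle_ball x (2 ^- m).
have mB : measurable Bx := measurable_circle_ball x _.
(* The dyadic interval of x and its two neighbours, in cyclic order. *)
pose c j := cyl m ((2 ^ m + code m x + j).-1 %% 2 ^ m) : set S1.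
have mc j : measurable (c j) by exact: measurable_cyl.
have sub : Bx `<=` (Bx `&` c 0%N) `|` (Bx `&` c 1%N) `|` (Bx `&` c 2%N).
  move=> y By; have [t ht Ey] := circle_ball_lift By.
  have two0 : (0 : R) < 2 ^+ m by rewrite exprn_gt0.
  (* The translation by 1 keeps the lift nonnegative; it adds 2^m to the
     integer part, hence the reduction modulo 2^m in c. *)
  have v0 : 0 <= fpart x + t + 1.
    have := fpart_ge0 x; have : `|t| < 1.
      by apply: lt_le_trans ht _; rewrite invf_le1 // exprn_ege1 // ler1n.
    by rewrite ltr_norml => /andP[? _]; lra.
  have Ey' : y = proj (fpart x + t + 1).
    by rewrite Ey; apply/esym/proj_eqP; exists 1.
  have := code_proj m v0; rewrite -Ey'.
  set k := Num.truncn _ => Ek.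
  have /andP[k1 k2] := truncn_itv (mulr_ge0 (ltW two0) v0); rewrite -/k in k1 k2.
  have /andP[h1 h2] := code_itv m x.
  have tt : `|2 ^+ m * t| < 1.
    by rewrite normrM (ger0_norm (ltW two0)) -ltr_pdivlMl // mulr1.
  move: tt; rewrite ltr_norml => /andP[t1 t2].
  have v1E : 2 ^+ m * (fpart x + t + 1) = 2 ^+ m * fpart x + 2 ^+ m * t + 2 ^+ m by ring.
  rewrite {}v1E in k1 k2; rewrite -natr1 in k2; rewrite -[(code m x).+1%:R]natr1 in h2.
  have e1 : (2 ^ m + code m x < k + 2)%N.
    by rewrite -(ltr_nat R) !natrD natrX; lra.
  have e2 : (k < 2 ^ m + code m x + 2)%N.
    by rewrite -(ltr_nat R) !natrD natrX; lra.
  have [j j3 kE] : exists2 j, (j < 3)%N & k = (2 ^ m + code m x + j).-1.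
    by exists (k + 1 - (2 ^ m + code m x))%N; lia.
  have cj : c j y by rewrite /c /cyl /= Ek kE.
  by case: j j3 kE cj => [|[|[|//]]] _ _ cj; [left; left|left; right|right].
have mBc j : measurable (Bx `&` c j) by exact: measurableI.
apply: (le_trans (prob_le nu mB _ sub)).
  by apply: measurableU => //; apply: measurableU.
apply: (le_trans (prob_subadd nu _ (mBc 2%N))); first exact: measurableU.
have := prob_subadd nu (mBc 0%N) (mBc 1%N).
have c012 j : P (Bx `&` c j) <= C * 2 `^ (birkhoff_sum phi m x + K) by exact: ball_cyl_le.
by have := c012 0%N; have := c012 1%N; have := c012 2%N; lra.
Qed.

End ball_measure.

(** * Targets that are hit finitely often *)

Section shrinking_targets_missed.
Variable R : realType.
Local Notation S1 := (circle R).
Local Notation proj := (\pi_(circle R) : R -> circle R).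
Local Notation T := (@doubling R).
Variables (phi : S1 -> R) (nu : probability S1 R) (C K kappa b : R) (x : S1).
Hypothesis inv : invariant_measure T nu.
Hypothesis C0 : 0 < C.
Hypothesis gibbs : gibbs_bounds phi nu C.
Hypothesis distortion : forall n (s t : R), `|s - t| <= 2 ^- n ->
  `|birkhoff_sum phi n (proj s) - birkhoff_sum phi n (proj t)| <= K.
Hypotheses (kappa0 : 0 < kappa) (b0 : 0 < b) (kb : 1 < kappa * b).
Hypothesis sum_small : forall m, birkhoff_sum phi m x <= - (b * m%:R).

(* m i: the largest scale with 2^(- m i) >= n^-kappa for all n >= 2^i. *)
Let m i := Num.truncn (kappa * i%:R).

Lemma target_ball i n (s : S1) : (2 ^ i <= n)%N -> target_interval kappa n s x ->
  circle_ball x (2 ^- m i) (iter n T s).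
Proof.
move=> ni /target_intervalE[t ht E]; exists t => //; apply: (lt_le_trans ht).
have n0 : (0 < n)%N by apply: leq_trans ni; rewrite expn_gt0.
have q0 : 0 < n%:R `^ kappa :> R by rewrite powR_gt0 // ltr0n.
rewrite powRN lef_pV2 // ?posrE ?exprn_gt0 //.
apply: (@le_trans _ _ (2 `^ (kappa * i%:R))).
  rewrite -powR_mulrn // pow2_le truncn_le mulr_ge0 // ltW //.
rewrite mulrC powRrM; apply: ge0_ler_powR; rewrite ?nnegrE ?powR_ge0 ?(ltW kappa0) //.
by rewrite powR_mulrn // -natrX ler_nat.
Qed.

(* F i: the orbit visits the ball of scale m i at a time in [2^i, 2^(i + 1)[. *)
Let F i : set S1 := [set s | exists2 j, (j < 2 ^ i)%N &
  (iter (2 ^ i + j) T @^-1` circle_ball x (2 ^- m i)) s].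

Let r : R := 2 `^ (1 - kappa * b).
Let M : R := 3 * C * 2 `^ (K + b).

Let F_small i : measurable (F i) /\ prob nu (F i) <= M * r ^+ i.
Proof.
have mB := measurable_circle_ball x (2 ^- m i).
have mTB j : measurable (iter (2 ^ i + j) T @^-1` circle_ball x (2 ^- m i)).
  by rewrite -[X in measurable X]setTI; exact: (measurable_iter (R := R)).
have PB j : prob nu (iter (2 ^ i + j) T @^-1` circle_ball x (2 ^- m i)) <=
    3 * (C * 2 `^ (K - b * (m i)%:R)).
  rewrite (prob_iter inv) //; apply: (le_trans (ball_le C0 gibbs distortion (m i) x)).
  by rewrite !ler_pM2l // pow2_le addrC lerD2l.
have [mF PF] := prob_finite_union_le (2 ^ i) mTB PB.
split=> //; apply: (le_trans PF).
have h : kappa * i%:R < (m i)%:R + 1 by rewrite natr1 truncnS_gt.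
have -> : (2 ^ i)%:R = 2 `^ (i%:R : R) by rewrite natrX powR_mulrn.
have -> : r ^+ i = 2 `^ ((1 - kappa * b) * i%:R) by rewrite powRrM powR_mulrn ?powR_ge0.
have -> : M * 2 `^ ((1 - kappa * b) * i%:R) =
    3 * (C * 2 `^ (K + b + (1 - kappa * b) * i%:R)).
  by rewrite powRD ?pnatr_eq0 ?implybT // /M -!mulrA.
have -> : 2 `^ i%:R * (3 * (C * 2 `^ (K - b * (m i)%:R))) =
    3 * (C * 2 `^ (i%:R + (K - b * (m i)%:R))).
  by rewrite [in RHS]powRD ?pnatr_eq0 ?implybT //; ring.
rewrite !ler_pM2l // pow2_le; apply: block_exponent.
by rewrite ler_pM2l // ltW.
Qed.

(** The first Borel-Cantelli lemma, applied to the dyadic blocks of times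
    [2^i, 2^(i + 1)[; with balls of radius 2^(- m i) it is enough to sum a
    geometric series. *)
Lemma approx_set_null : measurable [set s | approx_set kappa s x] ->
  nu [set s | approx_set kappa s x] = 0%E.
Proof.
move=> mA.
have mF i : measurable (F i) by have [] := F_small i.
have F0 : nu (lim_sup_set F) = 0%E.
  apply: (@borel_cantelli_geometric _ _ _ _ _ M r); rewrite ?powR_ge0 //.
  - by rewrite mulr_ge0 ?powR_ge0 // mulr_ge0 // ltW.
  - rewrite -[ltRHS](powRr0 2) /r ltNge pow2_le -ltNge.
    by rewrite subr_lt0.
  - by move=> i; have [] := F_small i.
apply: subset_measure0 F0 => //.
  by apply: bigcapT_measurable => i; apply: bigcup_measurable => j _.
move=> s Hs i _; have [] := Hs (2 ^ i)%N; first by rewrite /= expn_gt0.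
move=> n /= ni Hn.
have n0 : (0 < n)%N by apply: leq_trans ni; rewrite expn_gt0.
have /andP[h1 h2] := trunc_log_bounds (ltnSn 1) n0.
set k := trunc_log 2 n in h1 h2.
exists k => /=; first by rewrite -ltnS -(ltn_exp2l _ _ (ltnSn 1)); exact: leq_ltn_trans h2.
exists (n - 2 ^ k)%N; first by rewrite ltn_subLR // addnn -mul2n -expnS.
by rewrite /= subnKC //; exact: target_ball.
Qed.

End shrinking_targets_missed.

(** * Exchange of null sections *)

Section fubini_null.
Context d1 d2 (T1 : measurableType d1) (T2 : measurableType d2) (R : realType).
Variables (P : probability T1 R) (Q : probability T2 R).

(** Tonelli: if almost all horizontal sections of A are null, then so are almost
    all vertical ones. *)
Lemma ae_xsection_null (A : set (T1 * T2)) : measurable A ->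
  {ae Q, forall y, P (ysection A y) = 0%E} -> {ae P, forall x, Q (xsection A x) = 0%E}.
Proof.
move=> mA Hy.
have mx := measurable_fun_xsection Q mA.
have my := measurable_fun_ysection P mA.
have E := @indic_fubini_tonelli _ _ T1 T2 R P Q A mA.
rewrite indic_fubini_tonelli_FE // indic_fubini_tonelli_GE // in E.
have Gz : (\int[Q]_y (P \o ysection A) y = 0)%E.
  rewrite -[RHS](integral0 Q setT); apply: ge0_ae_eq_integral => //.
  by move: Hy; apply: filterS => y Hy _.
have Fz : (\int[P]_x `|(Q \o xsection A) x| = 0)%E.
  by rewrite -[RHS]Gz -E; apply: eq_integral => x _; rewrite gee0_abs.
have := (ae_eq_integral_abs P measurableT mx).1 Fz.
by apply: filterS => x /(_ I).
Qed.

End fubini_null.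

(** * The critical exponent *)

Section critical_exponent.
Variable R : realType.
Local Notation S1 := (circle R).
Local Notation proj := (\pi_(circle R) : R -> circle R).
Local Notation T := (@doubling R).

Lemma measurable_approx kappa :
  measurable [set p : S1 * S1 | approx_set kappa p.1 p.2].
Proof.
rewrite (_ : [set _ | _] = \bigcap_(N in [set N | (1 <= N)%N])
   \bigcup_(n in [set n | (N <= n)%N])
     [set p : S1 * S1 | target_interval kappa n p.1 p.2]); last first.
  by apply/seteqP; split=> p H N N1; have [n] := H N N1; exists n.
rewrite bigcap_mkcond; apply: bigcapT_measurable => N.
case: ifP => _; last exact: measurableT.
by apply: bigcup_measurable => n _; exact: measurable_target.
Qed.

Lemma ysectionE (A : S1 -> S1 -> Prop) x :
  ysection [set p | A p.1 p.2] x = [set s | A s x].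
Proof. by apply/seteqP; split=> s /=; rewrite /ysection /= inE. Qed.

Lemma xsectionE (A : S1 -> S1 -> Prop) s :
  xsection [set p | A p.1 p.2] s = [set x | A s x].
Proof. by apply/seteqP; split=> x /=; rewrite /xsection /= inE. Qed.

Variables (phi psi : S1 -> R) (mu nu : probability S1 R).
Hypotheses (holder_phi : holder_continuous phi).
Hypotheses (gibbs_mu : gibbs_measure phi mu) (gibbs_nu : gibbs_measure psi nu).
Local Notation alpha := (expect nu (fun x => - phi x)).

Lemma energy_pos : 0 < alpha.
Proof.
have [B B0 phiB] := holder_bounded holder_phi.
have [_ [C C0 gmu]] := gibbs_mu; have [inu _] := gibbs_nu.
exact: (energy_gt0 inu C0 gmu phiB (holder_measurable holder_phi)).
Qed.

Lemma approx_full kappa : 0 < kappa -> kappa * alpha < 1 ->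
  {ae mu, forall s, nu (approx_set kappa s) = 1%E}.
Proof.
move=> k0 ka; have a0 := energy_pos.
have [B B0 phiB] := holder_bounded holder_phi.
have mphi := holder_measurable holder_phi.
have [_ [C C0 gmu]] := gibbs_mu; have [inu [K K0 gnu]] := gibbs_nu.
have ki : alpha < kappa^-1 by rewrite -[ltRHS]mul1r ltr_pdivlMr // mulrC.
pose b := (alpha + kappa^-1) / 2.
have ab : alpha < b by rewrite /b; lra.
have bk : b < kappa^-1 by rewrite /b; lra.
have b0 : 0 < b by exact: lt_trans ab.
have kb : kappa * b < 1 by rewrite -(mulfV (lt0r_neq0 k0)) ltr_pM2l.
have mA := measurable_approx kappa.
suff : {ae mu, forall s, nu (xsection (~` [set p | approx_set kappa p.1 p.2]) s) = 0%E}.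
  apply: filterS => s.
  rewrite -[~` _]/[set p | ~ approx_set kappa p.1 p.2]
    (xsectionE (fun s x => ~ approx_set kappa s x)).
  rewrite -[[set x | _]]/(~` (approx_set kappa s)).
  have mas : measurable (approx_set kappa s).
    rewrite (_ : approx_set kappa s = [set x | approx_set kappa s x]) //.
    by rewrite -(xsectionE (approx_set kappa)); exact: measurable_xsection.
  rewrite (probE nu (measurableC mas)) (probE nu mas) probC // => /eqP.
  by rewrite eqe subr_eq0 => /eqP <-.
apply: ae_xsection_null; first exact: measurableC.
(* X N: points with a mu-large dyadic neighbourhood at some scale m >= N. *)
pose X N := [set x : S1 | exists2 m, (N <= m)%N &
    2 `^ (- (b * m%:R)) <= prob mu (cyl m (code m x))].
have mX N : measurable (X N).
  rewrite (_ : X N = \bigcup_(m in [set m | (N <= m)%N])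
    [set x | 2 `^ (- (b * m%:R)) <= prob mu (cyl m (code m x))]).
    apply: bigcup_measurable => m _.
    exact: (measurable_code m [set k | 2 `^ (- (b * m%:R)) <= prob mu (cyl m k)]).
  by apply/seteqP; split=> x [m] *; exists m.
have X0 N : prob nu (~` X N) = 0.
  exact: (infinitely_many_large_cyl inu C0 K0 gmu gnu phiB mphi ab).
have mXC N := measurableC (mX N).
exists (\bigcup_N ~` X N); split.
- exact: bigcupT_measurable.
- by rewrite (probE nu (bigcupT_measurable _ mXC)) prob_bigcup0.
move=> x /= nx; apply: contrapT => nXx; apply: nx.
have large N : X N x by apply: contrapT => nX; apply: nXx; exists N.
rewrite -[~` _]/[set p | ~ approx_set kappa p.1 p.2]
  (ysectionE (fun s x => ~ approx_set kappa s x)).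
(* The limsup set only involves times n >= 1. *)
pose Y N := [set s | forall n, (N.+1 <= n)%N -> ~ target_interval kappa n s x].
have mY N : measurable (Y N).
  rewrite (_ : Y N = \bigcap_(n in [set n | (N.+1 <= n)%N])
      ~` ysection [set p | target_interval kappa n p.1 p.2] x).
    rewrite bigcap_mkcond; apply: bigcapT_measurable => n.
    case: ifP => _; last exact: measurableT.
    by apply: measurableC; apply: measurable_ysection; exact: measurable_target.
  apply/seteqP; split=> s Hs n nN; have := Hs n nN;
    by rewrite (ysectionE (target_interval kappa n)).
have E : [set s | ~ approx_set kappa s x] = \bigcup_N Y N.
  apply/seteqP; split=> s /=.
    move=> ns; apply: contrapT => nY; apply: ns => -[//|N] _.
    apply: contrapT => nt; apply: nY; exists N => // n nN tn.
    by apply: nt; exists n.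
  by move=> [N _ YN] /(_ N.+1 isT) [n nN tn]; exact: (YN n nN tn).
rewrite E (probE mu (bigcupT_measurable _ mY)) prob_bigcup0 // => N.
exact: (target_hit C0 gmu k0 b0 kb large (mY N)).
Qed.

Lemma approx_not_full kappa : 0 < kappa -> 1 < kappa * alpha ->
  ~ {ae mu, forall s, nu (approx_set kappa s) = 1%E}.
Proof.
move=> k0 ka Hae; have a0 := energy_pos.
have [B B0 phiB] := holder_bounded holder_phi.
have [D D0 distortion] := holder_distortion holder_phi.
have mphi := holder_measurable holder_phi.
have bphi : bounded_measurable phi by split=> //; exists B.
have [imu [C C0 gmu]] := gibbs_mu; have [inu _] := gibbs_nu.
have ki : kappa^-1 < alpha by rewrite -[ltLHS]mul1r ltr_pdivrMr // mulrC.
pose b := (alpha + kappa^-1) / 2.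
have ab : b < alpha by rewrite /b; lra.
have bk : kappa^-1 < b by rewrite /b; lra.
have b0 : 0 < b by apply: lt_trans bk; rewrite invr_gt0.
have kb : 1 < kappa * b by rewrite -[ltLHS](mulfV (lt0r_neq0 k0)) ltr_pM2l.
(* g has mean alpha - b > 0; on G, minus the Birkhoff sum of phi at any time m
   is at least b m. *)
pose g x := - phi x + - b.
have bNphi := bounded_measurableN bphi.
have bg : bounded_measurable g.
  exact: (bounded_measurableD bNphi (bounded_measurable_cst (- b))).
have g0 : 0 < expect nu g.
  rewrite /g (expectD nu bNphi (bounded_measurable_cst (- b))) expect_cst subr_gt0.
  exact: ab.
pose G := [set x : S1 | forall n, 0 <= \sum_(j < n) g (iter j T x)].
have mT := @measurable_doubling R.
have mG : measurable G := measurable_sums_ge0 mT bg.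
have G0 : 0 < prob nu G := maximal_ergodic mT inu bg g0.
have Gs x m : G x -> birkhoff_sum phi m x <= - (b * m%:R).
  move=> /(_ m); rewrite /g big_split /= sumrN sumr_const card_ord.
  by rewrite -/(birkhoff_sum phi m x) mulNrn -[b *+ m]mulr_natr; lra.
have mA : measurable ([set p : S1 * S1 | approx_set kappa p.1 p.2] `&` (setT `*` G)).
  by apply: measurableI; [exact: measurable_approx|exact: measurableX].
have : {ae mu, forall s, nu (xsection
    ([set p | approx_set kappa p.1 p.2] `&` (setT `*` G)) s) = 0%E}.
  apply: ae_xsection_null => //; apply: aeW => x.
  have [Gx|nGx] := pselect (G x); last first.
    rewrite (_ : ysection _ x = set0) ?measure0 // -subset0 => s.
    by rewrite /ysection /= inE => -[_ [_]].
  have mAx : measurable [set s | approx_set kappa s x].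
    rewrite -(ysectionE (approx_set kappa)); apply: measurable_ysection.
    exact: measurable_approx.
  have L0 := approx_set_null imu C0 gmu distortion k0 b0 kb (fun m => Gs x m Gx) mAx.
  apply: subset_measure0 L0 => //; first exact: measurable_ysection.
  by move=> s; rewrite /ysection /= inE => -[].
move=> H0.
suff [N [_ N0 NT]] : {ae mu, forall s : S1, False}.
  have NE : N = setT by rewrite -subTset => s _; exact: NT.
  have := probT mu; rewrite /prob -NE N0 => /eqP.
  by rewrite eq_sym oner_eq0.
move: Hae H0; apply: filterS2 => s H1 H2.
have mas : measurable (approx_set kappa s).
  rewrite (_ : approx_set kappa s = [set x | approx_set kappa s x]) //.
  rewrite -(xsectionE (approx_set kappa)); apply: measurable_xsection.
  exact: measurable_approx.
have E : xsection ([set p | approx_set kappa p.1 p.2] `&` (setT `*` G)) s =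
    G `&` approx_set kappa s.
  by apply/seteqP; split=> x; rewrite /xsection /= inE /= => -[] // ? [].
have GA : prob nu (G `&` approx_set kappa s) = 0 by rewrite /prob -E H2.
have := probC nu mas.
have -> : prob nu (approx_set kappa s) = 1 by rewrite /prob H1.
rewrite subrr => Ac.
have := prob_setIC nu mG mas; rewrite GA add0r.
have : prob nu (G `&` ~` approx_set kappa s) <= prob nu (~` approx_set kappa s).
  apply: prob_le; [|exact: measurableC|exact: subIsetr].
  by apply: measurableI => //; exact: measurableC.
by rewrite Ac; lra.
Qed.

End critical_exponent.

Theorem theorem1p1 (R : realType) (phi psi : circle R -> R)
    (nu_phi nu_psi : probability (circle R) R)
    (holder_phi : holder_continuous phi) (holder_psi : holder_continuous psi)
    (normalized_phi : normalized phi) (normalized_psi : normalized psi)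
    (gibbs_phi : gibbs_measure phi nu_phi)
    (gibbs_psi : gibbs_measure psi nu_psi) :
  critical_exponent nu_phi nu_psi = (1 / \int[nu_psi]_x (- phi x)%:E)%E.
Proof.
have a0 := energy_pos holder_phi gibbs_phi gibbs_psi.
have [B B0 phiB] := holder_bounded holder_phi.
have bphi : bounded_measurable phi by split; [exact: holder_measurable|exists B].
rewrite (expectE nu_psi (bounded_measurableN bphi)) div1e inver gt_eqF //.
have full k : 0 < k -> k < (expect nu_psi (fun x => - phi x))^-1 ->
    {ae nu_phi, forall s, nu_psi (approx_set k s) = 1%E}.
  move=> k0 ka; apply: (approx_full holder_phi gibbs_phi gibbs_psi) => //.
  by rewrite -ltr_pdivlMr // mul1r.
have nfull k : 0 < k -> {ae nu_phi, forall s, nu_psi (approx_set k s) = 1%E} ->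
    k <= (expect nu_psi (fun x => - phi x))^-1.
  move=> k0 H; rewrite leNgt; apply/negP => ka.
  apply: (approx_not_full holder_phi gibbs_phi gibbs_psi k0 _ H).
  by rewrite -ltr_pdivrMr // mul1r.
move: (expect nu_psi (fun x => - phi x)) a0 full nfull => a a0 full nfull.
apply/eqP; rewrite eq_le; apply/andP; split.
  apply: ge_ereal_sup => _ [k [k0 H] <-]; rewrite lee_fin; exact: nfull.
have ai0 : 0 < a^-1 by rewrite invr_gt0.
have ub k : 0 < k -> k < a^-1 -> (k%:E <= critical_exponent nu_phi nu_psi)%E.
  by move=> k0 ka; apply: ereal_sup_ubound; exists k => //; split=> //; exact: full.
move: (critical_exponent _ _) ub => [u| |] ub; last 2 first.
- exact: leey.
- have h : a^-1 / 2 < a^-1 by lra.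
  by have := ub (a^-1 / 2) (divr_gt0 ai0 (ltr0Sn _ _)) h; rewrite leeNy_eq.
rewrite lee_fin leNgt; apply/negP => ua.
have := ub ((Num.max 0 u + a^-1) / 2).
rewrite lee_fin; case: (leP 0 u) => u0 H.
  have : (u + a^-1) / 2 <= u by apply: H; lra.
  lra.
have : (0 + a^-1) / 2 <= u by apply: H; lra.
lra.
Qed.
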